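(* Let $a<b$ and let $\sigma:[a,b]\to[0,\infty)$ satisfy $\sigma(a)=\sigma(b)=0$, $\sigma(x)>0$ for all $x\in(a,b)$, and $\sigma$ locally Hölder-$1/2$ continuous on $(a,b)$. Let $Z$ be the $[a,b]$-valued solution of $$dZ_t=\sigma(Z_t)\,dW_t,\qquad Z_0=z\in[a,b],$$ with $W$ a standard Brownian motion. Then $Z_t$ converges almost surely, as $t\to\infty$, to a limit taking values in $\{a,b\}$, and the law of the limit is the generalized Bernoulli distribution $\mathcal{B}(a,b,z)$.
   Context: Locally Hölder-$1/2$ continuous on $(a,b)$ means: for every compact $K\subset(a,b)$ there is $C_K$ with $|\sigma(x)-\sigma(y)|\le C_K|x-y|^{1/2}$ for all $x,y\in K$. The generalized Bernoulli distribution $\mathcal{B}(a,b,z)$ is the probability law supported on $\{a,b\}$ with mean $z$, i.e. mass $\frac{z-a}{b-a}$ at $b$ and mass $1-\frac{z-a}{b-a}$ at $a$. The solution $Z$ is the unique absorbed strong solution: it remains constant after first hitting $a$ or $b$. *)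

(* Defs.v *)
From HB Require Import structures.
From mathcomp Require Import all_boot all_order all_algebra.
From mathcomp Require Import all_classical all_reals all_analysis.

Set Implicit Arguments.
Unset Strict Implicit.
Unset Printing Implicit Defensive.

Import Order.TTheory GRing.Theory Num.Theory.
Import numFieldNormedType.Exports.

Local Open Scope classical_set_scope.
Local Open Scope ring_scope.

Definition locally_holder (R : realType) (alpha a b : R) (f : R -> R) : Prop :=
  forall K : set R, compact K -> K `<=` `]a, b[ ->
    exists C : R, forall x y : R, K x -> K y ->
      `|f x - f y| <= C * `|x - y| `^ alpha.

Definition gbernoulli (R : realType) (a b z : R) (A : set R) : \bar R :=
  (((z - a) / (b - a))%:E * \d_b A + (1 - (z - a) / (b - a))%:E * \d_a A)%E.

(* A process is a map X : R -> T -> R of which only the values X t, 0 <= t,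
   matter; a filtration is a family F : R -> set (set T), likewise used at
   nonnegative times only. *)

Definition continuous_paths (R : realType) (T : Type) (X : R -> T -> R) : Prop :=
  forall w, {within `[0, +oo[, continuous (fun t => X t w)}.

Definition measurable_wrt (R : realType) (T : Type) (G : set (set T))
    (f : T -> R) : Prop :=
  forall B : set R, measurable B -> G (f @^-1` B).

Definition adapted (R : realType) (T : Type) (F : R -> set (set T))
    (X : R -> T -> R) : Prop :=
  forall t : R, 0 <= t -> measurable_wrt (F t) (X t).

Definition progressively_measurable (R : realType) (T : Type)
    (F : R -> set (set T)) (X : R -> T -> R) : Prop :=
  forall t : R, 0 <= t -> forall B : set R, measurable B ->
    <<s [set A `*` D | A in @measurable _ R & D in F t] >>
      [set p : R * T | 0 <= p.1 <= t /\ B (X p.1 p.2)].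

Definition mutually_independent (R : realType) (d : measure_display)
    (T : measurableType d) (P : probability T R) (n : nat)
    (X : 'I_n -> T -> R) : Prop :=
  forall B : 'I_n -> set R, (forall i, measurable (B i)) ->
    P (\bigcap_i (X i @^-1` B i)) =
    (\prod_(i < n) fine (P (X i @^-1` B i)))%:E.

(* The second parameter of normal_prob is the standard deviation. *)
Definition brownian_motion (R : realType) (d : measure_display)
    (T : measurableType d) (P : probability T R) (W : R -> T -> R) : Prop :=
  [/\ forall t : R, 0 <= t -> measurable_fun setT (W t),
      continuous_paths W,
      {ae P, forall w, W 0 w = 0},
      forall (s t : R) (B : set R), 0 <= s -> s < t -> measurable B ->
        P ([set w | B (W t w - W s w)]) = normal_prob 0 (Num.sqrt (t - s)) B &
      forall (n : nat) (t : nat -> R), 0 <= t 0%N ->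
        (forall i, t i <= t i.+1) ->
        mutually_independent P
          (fun (i : 'I_n) w => W (t i.+1) w - W (t i) w)].

(* The filtration generated by W, augmented by the P-null events. *)
Definition augmented_filtration (R : realType) (d : measure_display)
    (T : measurableType d) (P : probability T R) (W : R -> T -> R) (t : R) :
    set (set T) :=
  <<s [set A | exists (s : R) (B : set R),
         [/\ 0 <= s, s <= t, measurable B & A = W s @^-1` B]]
      `|` [set A | measurable A /\ P A = 0%E] >>.

(* \sum_(i < n) xi_i 1_]t_i, t_i.+1] *)
Record simple_process (R : realType) (T : Type) := SimpleProcess {
  sp_size : nat ;
  sp_time : nat -> R ;
  sp_coef : nat -> T -> R }.

Definition simple_adapted (R : realType) (T : Type) (F : R -> set (set T))
    (h : simple_process R T) : Prop :=
  forall i, (i < sp_size h)%N ->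
    [/\ 0 <= sp_time h i, sp_time h i <= sp_time h i.+1,
        measurable_wrt (F (sp_time h i)) (sp_coef h i) &
        exists M : R, forall w, `|sp_coef h i w| <= M].

Definition simple_value (R : realType) (T : Type) (h : simple_process R T)
    (s : R) (w : T) : R :=
  \sum_(i < sp_size h)
    sp_coef h i w * \1_(`]sp_time h i, sp_time h i.+1]) s.

Definition simple_integral (R : realType) (T : Type) (W : R -> T -> R)
    (h : simple_process R T) (t : R) (w : T) : R :=
  \sum_(i < sp_size h)
    sp_coef h i w *
    (W (Num.min (sp_time h i.+1) t) w - W (Num.min (sp_time h i) t) w).

Definition cvg0_in_probability (R : realType) (d : measure_display)
    (T : measurableType d) (P : probability T R) (X : nat -> T -> \bar R) :
    Prop :=
  forall eps : R, 0 < eps ->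
    P [set w | (eps%:E <= X n w)%E] @[n --> \oo] --> 0%E.

Definition locally_square_integrable (R : realType) (d : measure_display)
    (T : measurableType d) (P : probability T R) (F : R -> set (set T))
    (H : R -> T -> R) : Prop :=
  progressively_measurable F H /\
  forall t : R, 0 <= t -> {ae P, forall w,
    (\int[@lebesgue_measure R]_(s in `[0%R, t]) (H s w ^+ 2)%:E < +oo)%E}.

(* I is (a version with continuous paths of) the Ito integral
   I_t = \int_0^t H dW of an integrand H that is square integrable in time on
   bounded intervals almost surely, but not necessarily in mean: for every
   horizon S, I is the limit, uniformly on [0, S] in probability, of the
   integrals of simple processes h n with \int_0^S (h n - H)^2 ds --> 0 in
   probability. *)
Definition ito_integral (R : realType) (d : measure_display)
    (T : measurableType d) (P : probability T R) (F : R -> set (set T))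
    (W H I : R -> T -> R) : Prop :=
  [/\ locally_square_integrable P F H, adapted F I, continuous_paths I &
      forall S : R, 0 <= S -> exists h : nat -> simple_process R T,
        [/\ forall n, simple_adapted F (h n),
            cvg0_in_probability P (fun n w =>
              \int[@lebesgue_measure R]_(s in `[0%R, S])
                 ((simple_value (h n) s w - H s w) ^+ 2)%:E)%E &
            cvg0_in_probability P (fun n w =>
              ereal_sup [set (`|simple_integral W (h n) t w - I t w|)%:E
                        | t in `[0, S]])]].

(* Strong solution of dZ_t = sigma(Z_t) dW_t, Z_0 = z, on the given probability
   space and for the given Brownian motion W. *)
Definition strong_solution (R : realType) (d : measure_display)
    (T : measurableType d) (P : probability T R) (W : R -> T -> R)
    (sigma : R -> R) (z : R) (Z : R -> T -> R) : Prop :=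
  let F := augmented_filtration P W in
  [/\ adapted F Z, continuous_paths Z, {ae P, forall w, Z 0 w = z} &
      exists I : R -> T -> R,
        ito_integral P F W (fun t w => sigma (Z t w)) I /\
        {ae P, forall w, forall t : R, 0 <= t -> Z t w = z + I t w}].

Definition absorbed (R : realType) (d : measure_display)
    (T : measurableType d) (P : probability T R) (a b : R)
    (Z : R -> T -> R) : Prop :=
  {ae P, forall w, forall s t : R, 0 <= s -> s <= t ->
    (Z s w = a \/ Z s w = b) -> Z t w = Z s w}.

(* Main.v *)
Require Import Defs.
From HB Require Import structures.
From mathcomp Require Import all_boot all_order all_algebra.
From mathcomp Require Import all_classical all_reals all_analysis.
From mathcomp Require Import measurable_realfun.
From mathcomp Require Import ring lra.

Set Implicit Arguments.
Unset Strict Implicit.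
Unset Printing Implicit Defensive.

Import Order.TTheory GRing.Theory Num.Theory.
Import numFieldNormedType.Exports.

Local Open Scope classical_set_scope.
Local Open Scope ring_scope.

(** The proof rests on one exponential.  Let h be a simple adapted integrand
with integral J and energy Q, the integral of h^2 in time.  The Laplace
transform of the normal law and the independence of Brownian increments from
the augmented past show that exp (J - Q/2) has mean 1
([exponential_martingale]).  Over a grid interval the energy to be spent is
already known at the left end, so h can be switched off just before its energy
exceeds a level K, without overshoot.  What is left is the exponential at a
random grid time, with second moment at most exp K ([stopped_exponential]).

Now let simple integrals J approximate the integral I of sigma(Z), so that
J is uniformly close to I = Z - z, whose increments are bounded by b - a.  Off
an event of small probability the stopped exponentials are then bounded by a
constant that does not depend on K, and on that event the second moment
controls them.  In the limit, for every real lam, all s <= S and every event B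
of the past of s,

   1 <= E [exp (lam 1_B (Z_S - Z_s) - lam^2/4 1_B (A_S - A_s))],

where A is the energy of sigma(Z) ([exp_integral_ge1]).  Of this energy only
the almost sure finiteness on bounded intervals is known, since sigma may blow
up at a and b; this is why exponentials, and not second moments of Z, carry
the argument.

This inequality is used twice.  Dropping the energy and comparing first orders
at lam = 0, from both sides, gives E [1_B (Z_S - Z_s)] = 0: Z is a
martingale ([martingale_increment]).  Bounding Z_S - Z_0 by b - a and letting
lam decrease to 0 shows that the total energy is almost surely finite
([energy_bounded]).

Since sigma is bounded below by a positive constant on compact subsets of
]a, b[, finite energy forces the gap min (Z - a, b - Z) to come arbitrarily
close to 0.  A concave function of a martingale, the gap is a nonnegative
supermartingale; once below delta it climbs to eta with probability at most
delta / eta ([crossing_probability]).  So it tends to 0 ([gap_cvg0]), and by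
continuity Z tends to a or to b ([solution_cvg]).  The mean z passes to the
limit by dominated convergence and determines a law carried by {a, b}. *)

(** * Laplace transform of the normal law *)
Lemma integral_normal_prob (R : realType) (m s : R) (f : R -> \bar R) :
  measurable_fun setT f -> (forall x, 0 <= f x)%E ->
  (\int[normal_prob m s]_x f x =
   \int[lebesgue_measure]_x (f x * (normal_pdf m s x)%:E))%E.
Proof.
move=> mf f0.
have dom := normal_prob_dominates m s.
rewrite -(Radon_Nikodym_SigmaFinite.change_of_variables dom)//.
have mg : measurable_fun setT
    (Radon_Nikodym_SigmaFinite.f (normal_prob m s) (@lebesgue_measure R)).
  apply: measurable_int; exact: Radon_Nikodym_SigmaFinite.f_integrable.
apply: ae_eq_integral => //.
- exact: emeasurable_funM.
- apply: emeasurable_funM => //; apply/measurable_EFinP.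
  exact: measurable_normal_pdf.
- apply: ae_eqe_mul2l => /=.
  apply: integral_ae_eq => //=.
  + exact: Radon_Nikodym_SigmaFinite.f_integrable.
  + by apply/measurable_EFinP; exact: measurable_normal_pdf.
  + by move=> E _ mE; rewrite -Radon_Nikodym_SigmaFinite.f_integral.
Qed.

(** Completing the square: exp (c x - c^2 v / 2) times the centred normal
density of variance v is the normal density of mean c v. *)
Lemma normal_exp_moment (R : realType) (c v : R) : 0 < v ->
  (\int[normal_prob 0%R (Num.sqrt v)]_x
     (expR (c * x - c ^+ 2 * v / 2))%:E = 1)%E.
Proof.
move=> v0; rewrite integral_normal_prob//; last first.
  apply/measurable_EFinP; apply: measurableT_comp => //.
  by apply: measurable_funB => //; exact: measurable_funM.
rewrite -[RHS](integral_normal_pdf (c * v) (Num.sqrt v)).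
apply: eq_integral => x _; rewrite -EFinM; congr EFin.
have s0 : Num.sqrt v != 0 by rewrite gt_eqF// sqrtr_gt0.
rewrite !normal_pdfE// mulrCA; congr (_ * _).
rewrite /normal_fun -expRD sqr_sqrtr ?ltW//; congr expR.
by field; rewrite gt_eqF.
Qed.

(** * Independence of Brownian increments from the past *)
Lemma ae_eq_probability (R : realType) (d : measure_display)
    (T : measurableType d) (P : probability T R) (A B : set T) :
  measurable A -> measurable B -> {ae P, forall w, A w <-> B w} -> P A = P B.
Proof.
move=> mA mB [N [mN PN ABN]].
have sub (C D : set T) : measurable C -> measurable D ->
    (forall w, ~ N w -> C w -> D w) -> (P C <= P D)%E.
  move=> mC mD CD; rewrite (@le_trans _ _ (P (D `|` N)))//.
    apply: le_measure; rewrite ?inE//; first exact: measurableU.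
    by move=> w Cw; have [Nw|nNw] := pselect (N w); [right|left; exact: CD].
  have : (P (D `|` N) <= P D + P N)%E by exact: measureU2.
  by rewrite PN adde0.
have AB w : ~ N w -> (A w <-> B w).
  by move=> nNw; apply: contrapT => AB; apply: nNw; exact: ABN.
by apply/eqP; rewrite eq_le; apply/andP; split; apply: sub => // w /AB[].
Qed.

Lemma indep_g_sigma_algebra (R : realType) (d : measure_display)
    (T : measurableType d) (P : probability T R) (G : set (set T)) (C : set T) :
  setI_closed G -> G `<=` measurable -> measurable C ->
  (forall A, G A -> P (A `&` C) = (P A * P C)%E) ->
  forall A, <<s G >> A -> P (A `&` C) = (P A * P C)%E.
Proof.
move=> GI Gm mC GC.
have sGm : <<s G >> `<=` measurable.
  by apply: smallest_sub => //; exact: sigma_algebra_measurable.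
apply: (@dynkin_induction _ (g_sigma_algebraType G) G
  (fun A => P (A `&` C) = (P A * P C)%E)) => //.
- by rewrite setTI probability_setT mul1e.
- move=> S /sGm mS SC.
  have -> : ~` S `&` C = C `\` (S `&` C).
    by apply/seteqP; split=> w /=; [tauto|move=> [Cw SCw]; tauto].
  have PD : (P (C `\` (S `&` C)) = P C - P (S `&` C))%E.
    rewrite -[in RHS](setIidr (@subIsetr _ S C)); apply: measureD => //.
      exact: measurableI.
    by rewrite -ge0_fin_numE// fin_num_measure.
  by rewrite PD SC probability_setC// muleBl ?mul1e ?fin_num_measure//
    fin_num_adde_defl// fin_numN fin_num_measure.
- move=> F mF tF FC.
  have mF' n : d.-measurable (F n) by apply: sGm; exact: mF.
  have PF : (P (\bigcup_k F k) = \sum_(k <oo) P (F k))%E.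
    by rewrite measure_bigcup//=; apply: eq_eseriesl => n; rewrite in_setT.
  have PFC : (P (\bigcup_k F k `&` C) = \sum_(k <oo) P (F k `&` C))%E.
    rewrite setI_bigcupl measure_bigcup//=.
    - by apply: eq_eseriesl => n; rewrite in_setT.
    - by move=> i _; exact: measurableI.
    - exact: trivIset_setIr.
  rewrite PF PFC muleC -(fineK (fin_num_measure P _ mC)) -nneseriesZl//.
  by apply: eq_eseriesr => n _; rewrite FC muleC fineK// fin_num_measure.
Qed.

Lemma measurable_forall_ltn (d : measure_display) (T : measurableType d) n
    (A : nat -> set T) : (forall i, (i < n)%N -> measurable (A i)) ->
  measurable [set w | forall i, (i < n)%N -> A i w].
Proof.
move=> mA.
have -> : [set w | forall i, (i < n)%N -> A i w] =
    \bigcap_i (if (i < n)%N then A i else setT).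
  apply/seteqP; split=> [w Aw i _|w Aw i ilt]; first by case: ifPn => [/Aw|].
  by have := Aw i I; rewrite ilt.
by apply: bigcapT_measurable => i; case: ifPn => [/mA|].
Qed.

Section brownian_independence.
Context (R : realType) (d : measure_display) (T : measurableType d)
  (P : probability T R) (W : R -> T -> R).
Hypothesis hW : brownian_motion P W.

Local Notation F := (augmented_filtration P W).

Lemma brownian_measurable t : 0 <= t -> measurable_fun setT (W t).
Proof. by have [+ _ _ _ _] := hW; apply. Qed.

Lemma brownian_preimage_measurable t (B : set R) : 0 <= t -> measurable B ->
  measurable (W t @^-1` B).
Proof.
by move=> t0 mB; rewrite -[X in measurable X]setTI; exact: brownian_measurable.
Qed.

Lemma augmented_filtration_sub t : F t `<=` measurable.
Proof.
apply: smallest_sub; first exact: sigma_algebra_measurable.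
move=> _ [[s [B [s0 _ mB ->]]]|[mA _]//].
exact: brownian_preimage_measurable.
Qed.

Lemma augmented_filtration_mono s t : s <= t -> F s `<=` F t.
Proof.
move=> st; apply: sub_sigma_algebra2 => A [[u [B [u0 us mB ->]]]|A0].
  by left; exists u, B; split => //; exact: le_trans st.
by right.
Qed.

Lemma brownian_incr_measurable s t : 0 <= s -> 0 <= t ->
  measurable_fun setT (fun w => W t w - W s w).
Proof. by move=> s0 t0; apply: measurable_funB; exact: brownian_measurable. Qed.

Lemma brownian_incr_preimage s t (B : set R) : 0 <= s -> 0 <= t ->
  measurable B -> measurable ((fun w => W t w - W s w) @^-1` B).
Proof.
move=> s0 t0 mB; rewrite -[X in measurable X]setTI.
exact: brownian_incr_measurable.
Qed.

Let boxes (tau : nat -> R) k : set (set T) :=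
  [set A | exists2 B : nat -> set R, (forall i, measurable (B i)) &
    A = [set w | forall i, (i < k)%N -> B i (W (tau i.+1) w - W (tau i) w)]].

Lemma boxes_sub tau k : (forall i, 0 <= tau i) -> boxes tau k `<=` measurable.
Proof.
move=> tau0 _ [B mB ->].
apply: (measurable_forall_ltn
  (A := fun i => (fun w => W (tau i.+1) w - W (tau i) w) @^-1` B i)) => i _.
exact: brownian_incr_preimage.
Qed.

Lemma boxes_prob tau k (B : nat -> set R) : (forall i, 0 <= tau i) ->
  (forall i, tau i <= tau i.+1) -> (forall i, measurable (B i)) ->
  P [set w | forall i, (i < k)%N -> B i (W (tau i.+1) w - W (tau i) w)] =
  (\prod_(i < k) fine (P ((fun w => W (tau i.+1) w - W (tau i) w) @^-1` B i)))%:E.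
Proof.
move=> tau0 tauS mB; have [_ _ _ _ /(_ k tau (tau0 _) tauS)] := hW.
move=> /(_ (fun i => B i) (fun i => mB i)) <-; congr (P _).
apply/seteqP; split=> [w Bw i _|w Bw i ik]; first exact: Bw.
exact: (Bw (Ordinal ik)).
Qed.

(** For a fixed grid, boxes of increments are a pi-system, whereas cylinders
over different grids mix sums of increments; hence the detour through the
sigma-algebra of one grid. *)
Lemma boxes_indep tau k (B : set R) : (forall i, 0 <= tau i) ->
  (forall i, tau i <= tau i.+1) -> measurable B ->
  forall A, <<s boxes tau k >> A ->
  P (A `&` [set w | B (W (tau k.+1) w - W (tau k) w)]) =
  (P A * P [set w | B (W (tau k.+1) w - W (tau k) w)%R])%E.
Proof.
move=> tau0 tauS mB; apply: indep_g_sigma_algebra.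
- move=> _ _ [B1 mB1 ->] [B2 mB2 ->].
  exists (fun i => B1 i `&` B2 i); first by move=> i; exact: measurableI.
  by apply/seteqP; split=> [w [B1w B2w] i ik|w Bw];
    [split; [exact: B1w|exact: B2w]|split=> i /Bw[]].
- exact: boxes_sub.
- exact: brownian_incr_preimage.
- move=> _ [B' mB' ->].
  pose B2 i := if i == k then B else B' i.
  have mB2 i : measurable (B2 i) by rewrite /B2; case: ifP.
  have -> : [set w | forall i, (i < k)%N -> B' i (W (tau i.+1) w - W (tau i) w)]
       `&` [set w | B (W (tau k.+1) w - W (tau k) w)] =
      [set w | forall i, (i < k.+1)%N -> B2 i (W (tau i.+1) w - W (tau i) w)].
    apply/seteqP; split=> w /=.
      move=> [B'w Bw] i; rewrite ltnS /B2; case: eqVneq => [-> _ //|ik].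
      by rewrite leq_eqVlt (negbTE ik); exact: B'w.
    move=> Bw; split=> [i ik|]; last first.
      by have := Bw k (ltnSn k); rewrite /B2 eqxx.
    by have := Bw i (ltnW ik); rewrite /B2 (ltn_eqF ik).
  rewrite !boxes_prob// big_ord_recr/= EFinM {2}/B2 eqxx fineK; last first.
    by rewrite fin_num_measure//; exact: brownian_incr_preimage.
  congr (_%:E * _)%E; apply: eq_bigr => i _.
  by rewrite /B2 (ltn_eqF (ltn_ord i)).
Qed.

(** The sigma-algebra of the past is generated by the cylinders over finitely
many times, together with the null events, and these form a pi-system.  A
cylinder over times u_0, ..., u_(n-1) is, up to the null event W_0 <> 0, an
event of the increments along the sorted grid 0, u_i, ..., s. *)
Lemma brownian_incr_indep s t (B : set R) : 0 <= s -> s <= t -> measurable B ->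
  forall A, F s A -> P (A `&` [set w | B (W t w - W s w)]) =
    (P A * P [set w | B (W t w - W s w)%R])%E.
Proof.
move=> s0 st mB; have t0 := le_trans s0 st.
pose cyl n (u : nat -> R) (B' : nat -> set R) :=
  [set w | forall i, (i < n)%N -> B' i (W (u i) w)].
pose G : set (set T) := [set A | (exists n u B', [/\
  forall i, (i < n)%N -> 0 <= u i <= s, forall i, measurable (B' i) &
  A = cyl n u B']) \/ (measurable A /\ P A = 0%E)].
have mcyl n u B' : (forall i, (i < n)%N -> 0 <= u i <= s) ->
    (forall i, measurable (B' i)) -> measurable (cyl n u B').
  move=> u0 mB'.
  apply: (measurable_forall_ltn (A := fun i => W (u i) @^-1` B' i)) => i /u0.
  by move=> /andP[ui0 _]; exact: brownian_preimage_measurable.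
have null (A A' : set T) : measurable A -> measurable A' -> P A = 0%E ->
    P (A `&` A') = 0%E.
  move=> mA mA' PA; apply/eqP; rewrite eq_le measure_ge0 andbT -PA.
  by apply: le_measure; rewrite ?inE//; exact: measurableI.
have Gm : G `<=` measurable by move=> _ [[n [u [B' [u0 mB' ->]]]]|[]//]; exact: mcyl.
have mC : measurable [set w | B (W t w - W s w)] by exact: brownian_incr_preimage.
suff GC A : G A -> P (A `&` [set w | B (W t w - W s w)]) =
    (P A * P [set w | B (W t w - W s w)%R])%E.
  move=> A FA; apply: (@indep_g_sigma_algebra _ _ _ P G) => //.
    move=> A1 A2 GA1 GA2; have mA1 := Gm _ GA1; have mA2 := Gm _ GA2.
    move: GA1 GA2 => [[n1 [u1 [B1 [u01 mB1 ->]]]]|[_ PA1]]; last first.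
      by move=> _; right; split; [exact: measurableI|exact: null].
    move=> [[n2 [u2 [B2 [u02 mB2 ->]]]]|[_ PA2]]; last first.
      right; split; first by apply: measurableI => //; exact: mcyl.
      by rewrite setIC; apply: null => //; exact: mcyl.
    left; exists (n1 + n2)%N, (fun i => if (i < n1)%N then u1 i else u2 (i - n1)%N),
      (fun i => if (i < n1)%N then B1 i else B2 (i - n1)%N); split.
    - move=> i ilt; case: ifPn => [/u01//|]; rewrite -leqNgt => n1i.
      by apply: u02; rewrite ltn_subLR.
    - by move=> i; case: ifP.
    - apply/seteqP; split=> w /=.
        move=> [w1 w2] i ilt; case: ifPn => [/w1//|]; rewrite -leqNgt => n1i.
        by apply: w2; rewrite ltn_subLR.
      move=> w12; split=> i ilt.
        by have := w12 i (ltn_addr _ ilt); rewrite ilt.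
      have := w12 (n1 + i)%N; rewrite ltn_add2l => /(_ ilt).
      by rewrite ltnNge leq_addr/= addKn.
  apply: sub_sigma_algebra2 FA => A' [[u [B' [u0 us mB' ->]]]|]; last by right.
  left; exists 1%N, (fun=> u), (fun=> B'); split => //; first by rewrite u0 us.
  by apply/seteqP; split=> w /=; [move=> ? []|move=> /(_ 0%N); exact].
move=> [[n [u [B' [u0 mB' ->]]]]|[mA PA]]; last by rewrite null// PA mul0e.
pose l := sort <=%R (map u (iota 0 n)).
(* the grid is 0, the sorted times, s, and then t by default: the increment
   number n.+1 is W t - W s *)
pose tau i := nth t (0 :: rcons l s) i.
have sl : size l = n by rewrite size_sort size_map size_iota.
have lP x : x \in l -> 0 <= x <= s.
  by rewrite mem_sort => /mapP[i]; rewrite mem_iota => /andP[_ ilt] ->; exact: u0.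
have gP : path <=%R 0 (rcons l s).
  rewrite path_sortedE; last exact: le_trans.
  apply/andP; split.
    by rewrite all_rcons s0/=; apply/allP => x /lP/andP[].
  rewrite sorted_pairwise; last exact: le_trans.
  rewrite pairwise_rcons -sorted_pairwise; last exact: le_trans.
  rewrite sort_sorted ?andbT; last exact: le_total.
  by apply/allP => x /lP/andP[].
have tau0 i : 0 <= tau i.
  rewrite /tau; have [igt|ile] := leqP (size (0 :: rcons l s)) i.
    by rewrite nth_default.
  have := mem_nth t ile; rewrite inE => /predU1P[->//|].
  by rewrite mem_rcons inE => /predU1P[->//|/lP/andP[]].
have tauS i : tau i <= tau i.+1.
  have [igt|] := ltnP i (size (rcons l s)); first by have /(pathP t) := gP; exact.
  rewrite size_rcons sl => nle; rewrite [leRHS]nth_default ?size_rcons/= ?size_rcons ?sl//.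
  move: nle; rewrite leq_eqVlt => /predU1P[<-|nlt].
    by rewrite /tau/= nth_rcons sl ltnn eqxx.
  by rewrite /tau nth_default ?size_rcons//= size_rcons sl.
have tau_n : tau n.+1 = s by rewrite /tau/= nth_rcons sl ltnn eqxx.
have tau_n1 : tau n.+2 = t.
  by rewrite /tau nth_default//= size_rcons sl.
pose D : set (set T) := boxes tau n.+1.
have mD i : (i < n.+1)%N -> measurable_fun [set: g_sigma_algebraType D]
    (fun w => W (tau i.+1) w - W (tau i) w).
  move=> ilt _ B1 mB1; rewrite setTI; apply: sub_sigma_algebra.
  exists (fun j => if j == i then B1 else setT); first by move=> j; case: ifP.
  apply/seteqP; split=> w /=; last by move=> /(_ i ilt); rewrite eqxx.
  by move=> Bw j jlt; case: eqVneq => [->|].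
have mtau i : (i <= n.+1)%N -> measurable_fun [set: g_sigma_algebraType D]
    (fun w => W (tau i) w - W (tau 0%N) w).
  elim: i => [_|i IH ilt].
    by under eq_fun do rewrite subrr; exact: measurable_cst.
  have -> : (fun w => W (tau i.+1) w - W (tau 0%N) w) =
      (fun w => W (tau i.+1) w - W (tau i) w) \+
      (fun w => W (tau i) w - W (tau 0%N) w).
    by apply/funext => w/=; rewrite addrA subrK.
  by apply: measurable_funD; [exact: mD|apply: IH; exact: ltnW].
have mu0 i : (i < n)%N -> measurable_fun [set: g_sigma_algebraType D]
    (fun w => W (u i) w - W 0 w).
  move=> ilt; have /(nthP t)[j] : u i \in l.
    by rewrite mem_sort; apply: map_f; rewrite mem_iota.
  rewrite sl => jlt uj.
  have := @mtau j.+1 (ltnW jlt); rewrite {1}/tau/= nth_rcons sl jlt uj.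
  exact.
pose cyl' := [set w | forall i, (i < n)%N -> B' i (W (u i) w - W 0 w)].
have sDcyl' : <<s D >> cyl'.
  apply: (@measurable_forall_ltn _ (g_sigma_algebraType D) n
    (fun i => (fun w => W (u i) w - W 0 w) @^-1` B' i)) => i ilt.
  by rewrite -[X in measurable X]setTI; exact: mu0.
have mcyl' : d.-measurable cyl'.
  by apply: smallest_sub sDcyl'; [exact: sigma_algebra_measurable|exact: boxes_sub].
have aecyl : {ae P, forall w, cyl n u B' w <-> cyl' w}.
  have [_ _ + _ _] := hW; apply: filterS => w W0.
  by split=> + i ilt => /(_ i ilt); rewrite /= W0 subr0.
rewrite (@ae_eq_probability _ _ _ _ (cyl n u B') cyl')//; last exact: mcyl.
rewrite (@ae_eq_probability _ _ _ _ _ (cyl' `&` [set w | B (W t w - W s w)])).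
- by have := boxes_indep tau0 tauS mB sDcyl'; rewrite tau_n tau_n1.
- by apply: measurableI => //; exact: mcyl.
- exact: measurableI.
- by apply: filterS aecyl => w [h1 h2]; split=> -[h3 h4]; split => //; auto.
Qed.

End brownian_independence.

(** * Exponential martingale of a grid *)
(** The joint law of X and Y is the product of their laws, so that Tonelli's
theorem integrates Y out. *)
Lemma ge0_integral_indep (R : realType) (d d1 d2 : measure_display)
    (T : measurableType d) (T1 : measurableType d1) (T2 : measurableType d2)
    (P : probability T R) (Q : probability T2 R)
    (X : {mfun T >-> T1}) (Y : {mfun T >-> T2}) (f : T1 * T2 -> \bar R) :
  (forall A B, measurable A -> measurable B ->
     P (X @^-1` A `&` Y @^-1` B) = (P (X @^-1` A) * Q B)%E) ->
  measurable_fun setT f -> (forall z, 0 <= f z)%E ->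
  (\int[P]_w f (X w, Y w) = \int[P]_w \int[Q]_y f (X w, y))%E.
Proof.
move=> XY mf f0.
have mXY : measurable_fun setT (fun w => (X w, Y w)) by exact: measurable_fun_pair.
pose XY_ : {mfun T >-> (T1 * T2)%type} :=
  HB.pack (fun w => (X w, Y w)) (isMeasurableFun.Build _ _ _ _ _ mXY).
rewrite -(@ge0_integral_distribution _ _ _ _ _ P XY_ f)//.
rewrite -(@ge0_integral_distribution _ _ _ _ _ P X
  (fun x => \int[Q]_y f (x, y))%E)//; last 2 first.
- exact: (measurable_fun_fubini_tonelli_F (m2 := Q)).
- by move=> x; exact: integral_ge0.
rewrite -(fubini_tonelli1 (m1 := distribution P X) (m2 := Q))//.
apply: eq_measure_integral => A mA _; apply/esym.
by apply: product_measure_unique => // B C mB mC; exact: XY.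
Qed.

(** The generating events of the augmented filtration are named so that the
past at time t becomes a measurable type, on which the closure properties of
measurable functions are available. *)
Definition augmented_gen (R : realType) (d : measure_display)
    (T : measurableType d) (P : probability T R) (W : R -> T -> R) (t : R) :
    set (set T) :=
  [set A | exists (s : R) (B : set R),
         [/\ 0 <= s, s <= t, measurable B & A = W s @^-1` B]]
      `|` [set A | measurable A /\ P A = 0%E].

Section exponential_step.
Context (R : realType) (d : measure_display) (T : measurableType d)
  (P : probability T R) (W : R -> T -> R).
Hypothesis hW : brownian_motion P W.

Local Notation F := (augmented_filtration P W).
Local Notation FT s := (g_sigma_algebraType (augmented_gen P W s)).

Lemma measurable_wrtP s (f : T -> R) :
  measurable_wrt (F s) f <-> measurable_fun [set: FT s] f.
Proof.
split=> [mf _ B mB|mf B mB]; first by rewrite setTI; exact: (mf B mB).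
by have := mf measurableT B mB; rewrite setTI.
Qed.

Lemma measurable_wrt_fun s (f : T -> R) :
  measurable_wrt (F s) f -> measurable_fun setT f.
Proof.
by move=> mf _ B mB; rewrite setTI; apply: (augmented_filtration_sub hW); exact: mf.
Qed.

Lemma measurable_wrt_mono s t (f : T -> R) : s <= t ->
  measurable_wrt (F s) f -> measurable_wrt (F t) f.
Proof. by move=> st mf B mB; apply: (augmented_filtration_mono st); exact: mf. Qed.

Lemma brownian_adapted s t : 0 <= s -> s <= t -> measurable_wrt (F t) (W s).
Proof. by move=> s0 st B mB; apply: sub_sigma_algebra; left; exists s, B. Qed.

(** Conditionally on the past at time s, c and Y are constants and
W t - W s is an independent centred normal variable of variance t - s. *)
Lemma exponential_step s t (c Y : T -> R) : 0 <= s -> s <= t ->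
  measurable_wrt (F s) c -> measurable_wrt (F s) Y -> (forall w, 0 <= Y w) ->
  (\int[P]_w (Y w * expR (c w * (W t w - W s w) - c w ^+ 2 * (t - s) / 2))%:E =
   \int[P]_w (Y w)%:E)%E.
Proof.
move=> s0; rewrite le_eqVlt => /predU1P[<- _ _ _|st mc mY Y0].
  by apply: eq_integral => w _; rewrite !subrr mulr0 mulr0 mul0r subrr expR0 mulr1.
have t0 : 0 <= t by rewrite (le_trans s0)// ltW.
have mid : measurable_fun setT (fun w : T => w : FT s).
  by move=> _ A mA; rewrite setTI; apply: (augmented_filtration_sub hW); exact: mA.
pose id_ : {mfun T >-> FT s} :=
  HB.pack (fun w : T => w : FT s) (isMeasurableFun.Build _ _ _ _ _ mid).
have mincr : @measurable_fun _ _ T (measurableTypeR R) setT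
    (fun w => W t w - W s w) by exact: (brownian_incr_measurable hW s0 t0).
pose incr : {mfun T >-> measurableTypeR R} := HB.pack (fun w : T => W t w - W s w)
  (isMeasurableFun.Build _ _ _ _ _ mincr).
pose f (z : FT s * measurableTypeR R) : \bar R := (Y z.1 *
  expR (c z.1 * z.2 - c z.1 ^+ 2 * (t - s) / 2))%:E.
have mf : measurable_fun setT f.
  have mc1 : measurable_fun setT (fun z : FT s * measurableTypeR R => c z.1).
    by apply: measurableT_comp; [exact/measurable_wrtP|exact: measurable_fst].
  have mY1 : measurable_fun setT (fun z : FT s * measurableTypeR R => Y z.1).
    by apply: measurableT_comp; [exact/measurable_wrtP|exact: measurable_fst].
  apply/measurable_EFinP; apply: measurable_funM => //.
  apply: measurableT_comp => //; apply: measurable_funB.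
    by apply: measurable_funM => //; exact: measurable_snd.
  by apply: measurable_funM => //; apply: measurable_funM => //;
    exact: measurable_funX.
rewrite -[LHS]/(\int[P]_w f (id_ w, incr w))%E.
rewrite (@ge0_integral_indep _ _ _ _ _ _ _ P
  (normal_prob 0 (Num.sqrt (t - s))) id_ incr)//; last 2 first.
- move=> A B mA mB; rewrite [LHS](brownian_incr_indep hW s0 (ltW st) mB mA).
  by have [_ _ _ -> //] := hW.
- by move=> z; rewrite lee_fin mulr_ge0// expR_ge0.
apply: eq_integral => w _.
transitivity (\int[normal_prob 0 (Num.sqrt (t - s))]_y ((Y w)%:E *
   (expR (c w * y - c w ^+ 2 * (t - s) / 2))%:E))%E.
  by apply: eq_integral => y _; rewrite -EFinM.
have mexp : measurable_fun setT
    (fun y : R => (expR (c w * y - c w ^+ 2 * (t - s) / 2))%:E).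
  apply/measurable_EFinP; apply: measurableT_comp => //.
  by apply: measurable_funB => //; exact: measurable_funM.
rewrite ge0_integralZl//; last by rewrite lee_fin.
by rewrite normal_exp_moment ?subr_gt0// mule1.
Qed.

End exponential_step.

(** The partial energies A j increase with j, so the condition A i.+1 <= K
selects an initial segment of indices: the truncated sums are the original ones
up to some index j. *)
Lemma truncated_sums (R : realType) (c x dt : nat -> R) (K : R) n :
  0 <= K -> (forall i, (i < n)%N -> 0 <= dt i) ->
  let A j := \sum_(i < j) c i ^+ 2 * dt i in
  let ck i := if A i.+1 <= K then c i else 0 in
  exists j, [/\ (j <= n)%N, \sum_(i < n) ck i * x i = \sum_(i < j) c i * x i,
    \sum_(i < n) ck i ^+ 2 * dt i = A j, A j <= K & A n <= K -> j = n].
Proof.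
move=> K0 dt0 A ck.
have A_mono i j : (i <= j)%N -> (j <= n)%N -> A i <= A j.
  elim: j => [|j IH]; first by rewrite leqn0 => /eqP->.
  rewrite leq_eqVlt => /predU1P[->//|ij] jn.
  rewrite (le_trans (IH ij (ltnW jn)))// /A big_ord_recr/= lerDl.
  by rewrite mulr_ge0 ?sqr_ge0 ?dt0.
suff H m : (m <= n)%N -> exists j, [/\ (j <= m)%N,
    \sum_(i < m) ck i * x i = \sum_(i < j) c i * x i,
    \sum_(i < m) ck i ^+ 2 * dt i = A j, A j <= K &
    j = m \/ (j < m)%N /\ K < A j.+1].
  have [j [jn xj dtj AK jA]] := H n (leqnn n); exists j; split => // AnK.
  case: jA => // -[jltn]; rewrite ltNge => /negP[].
  by apply: le_trans AnK; exact: A_mono.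
elim: m => [_|m IH mn].
  by exists 0%N; split => //; rewrite /A ?big_ord0//; left.
have [j [jm xj dtj AK jA]] := IH (ltnW mn).
have [AmK|AmK] := leP (A m.+1) K.
  have jE : j = m.
    case: jA => // -[jltm]; rewrite ltNge => /negP[].
    by apply: le_trans AmK; apply: A_mono.
  exists m.+1; split => //; [| |by left].
  - by rewrite !big_ord_recr/= xj jE /ck AmK.
  - by rewrite /A !big_ord_recr/= dtj jE /ck AmK.
have ckm : ck m = 0 by rewrite /ck leNgt AmK.
exists j; split => //.
- by rewrite leqW.
- by rewrite big_ord_recr/= ckm mul0r addr0.
- by rewrite big_ord_recr/= ckm expr0n mul0r addr0.
- right; split => //; case: jA => [->//|[]//].
Qed.

Section exponential_martingale.
Context (R : realType) (d : measure_display) (T : measurableType d)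
  (P : probability T R) (W : R -> T -> R).
Hypothesis hW : brownian_motion P W.

Local Notation F := (augmented_filtration P W).
Local Notation FT s := (g_sigma_algebraType (augmented_gen P W s)).

Section grid.
Variables (n : nat) (tau : nat -> R).
Hypothesis tau0 : 0 <= tau 0%N.
Hypothesis tauS : forall i, (i < n)%N -> tau i <= tau i.+1.

Let tau_mono i j : (i <= j)%N -> (j <= n)%N -> tau i <= tau j.
Proof.
elim: j => [|j IH]; first by rewrite leqn0 => /eqP->.
rewrite leq_eqVlt => /predU1P[->//|ij] jn.
by rewrite (le_trans (IH ij (ltnW jn)))// tauS.
Qed.

Let tau_ge0 i : (i <= n)%N -> 0 <= tau i.
Proof. by move=> ilt; rewrite (le_trans tau0)// tau_mono. Qed.

Let M (c : nat -> T -> R) k w :=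
  \sum_(i < k) c i w * (W (tau i.+1) w - W (tau i) w).
Let A (c : nat -> T -> R) k w :=
  \sum_(i < k) c i w ^+ 2 * (tau i.+1 - tau i).

Lemma grid_adapted (c : nat -> T -> R) k : (k <= n)%N ->
  (forall i, (i < n)%N -> measurable_wrt (F (tau i)) (c i)) ->
  measurable_wrt (F (tau k)) (M c k) /\ measurable_wrt (F (tau k)) (A c k).
Proof.
move=> kn mc; split; apply/measurable_wrtP; apply: measurable_sum => i.
- have ikn : (i < n)%N := leq_trans (ltn_ord i) kn.
  apply: measurable_funM.
    apply/measurable_wrtP; apply: measurable_wrt_mono (mc _ ikn).
    by apply: tau_mono => //; exact: ltnW.
  by apply: measurable_funB; apply/measurable_wrtP; apply: brownian_adapted;
    rewrite ?tau_ge0 ?tau_mono// ltnW.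
- have ikn : (i < n)%N := leq_trans (ltn_ord i) kn.
  apply: measurable_funM => //; apply: measurable_funX.
  apply/measurable_wrtP; apply: measurable_wrt_mono (mc _ ikn).
  by apply: tau_mono => //; exact: ltnW.
Qed.

(** The energy up to tau k.+1 is known at time tau k: this is why switching off
before the energy exceeds a level keeps the integrand adapted. *)
Lemma grid_predictable (c : nat -> T -> R) k : (k < n)%N ->
  (forall i, (i < n)%N -> measurable_wrt (F (tau i)) (c i)) ->
  measurable_wrt (F (tau k)) (A c k.+1).
Proof.
move=> kn mc; apply/measurable_wrtP.
rewrite (_ : A c k.+1 = A c k \+ (fun w => c k w ^+ 2 * (tau k.+1 - tau k))).
  apply: measurable_funD.
    by apply/measurable_wrtP; apply: (grid_adapted (ltnW kn) mc).2.
  apply: measurable_funM => //; apply: measurable_funX.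
  by apply/measurable_wrtP; exact: mc.
by apply/funext => w; rewrite /A big_ord_recr.
Qed.

Lemma exponential_martingale (c : nat -> T -> R) :
  (forall i, (i < n)%N -> measurable_wrt (F (tau i)) (c i)) ->
  (\int[P]_w (expR (M c n w - A c n w / 2))%:E = 1)%E.
Proof.
move=> mc; suff H k : (k <= n)%N ->
    (\int[P]_w (expR (M c k w - A c k w / 2))%:E = 1)%E by exact: H.
elim: k => [_|k IH kn].
  under eq_integral do rewrite /M /A !big_ord0 mul0r subrr expR0.
  by rewrite integral_cst//= probability_setT mule1.
rewrite -(IH (ltnW kn)).
have [mM mA] := grid_adapted (ltnW kn) mc.
rewrite -[RHS](exponential_step hW (c := c k) (s := tau k) (t := tau k.+1))//.
- apply: eq_integral => w _; congr EFin.
  rewrite -expRD; congr expR; rewrite /M /A !big_ord_recr/=; lra.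
- by rewrite tau_ge0// ltnW.
- exact: tauS.
- exact: mc.
- apply/measurable_wrtP; apply: measurableT_comp => //.
  by apply: measurable_funB; [exact/measurable_wrtP|
    apply: measurable_funM => //; exact/measurable_wrtP].
Qed.

Variables (c : nat -> T -> R) (K : R).
Hypothesis mc : forall i, (i < n)%N -> measurable_wrt (F (tau i)) (c i).
Hypothesis K0 : 0 <= K.

Let ck i w := if A c i.+1 w <= K then c i w else 0.

Let mck i : (i < n)%N -> measurable_wrt (F (tau i)) (ck i).
Proof.
move=> ilt; apply/measurable_wrtP; apply: measurable_fun_ifT => //.
- apply: measurable_fun_ler => //.
  by apply/measurable_wrtP; exact: grid_predictable.
- by apply/measurable_wrtP; exact: mc.
Qed.

(** If Mk and Ak are the truncated integral and energy, then Ak <= K and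
exp (2 (Mk - Ak / 2)) = exp (2 Mk - 4 Ak / 2) exp Ak, whose first factor is the
exponential martingale of twice the integrand: this bounds the second
moment. *)
Lemma stopped_exponential : exists X : T -> R, [/\
  measurable_fun setT X, (\int[P]_w (X w)%:E = 1)%E,
  (\int[P]_w (X w ^+ 2)%:E <= (expR K)%:E)%E &
  forall w, exists j, [/\ (j <= n)%N, X w = expR (M c j w - A c j w / 2) &
    A c n w <= K -> j = n]].
Proof.
have mM := (grid_adapted (leqnn n) mck).1; have mA := (grid_adapted (leqnn n) mck).2.
exists (fun w => expR (M ck n w - A ck n w / 2)); split.
- apply: (@measurable_wrt_fun _ _ _ P W hW (tau n)).
  apply/measurable_wrtP; apply: measurableT_comp => //.
  by apply: measurable_funB; [exact/measurable_wrtP|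
    apply: measurable_funM => //; exact/measurable_wrtP].
- exact: exponential_martingale.
- pose c2 i w := 2 * ck i w.
  have mc2 i : (i < n)%N -> measurable_wrt (F (tau i)) (c2 i).
    move=> ilt; apply/measurable_wrtP; apply: measurable_funM => //.
    by apply/measurable_wrtP; exact: mck.
  have mM2 := measurable_wrt_fun hW (grid_adapted (leqnn n) mc2).1.
  have mA2 := measurable_wrt_fun hW (grid_adapted (leqnn n) mc2).2.
  have -> : ((expR K)%:E = (expR K)%:E *
      \int[P]_w (expR (M c2 n w - A c2 n w / 2))%:E)%E.
    by rewrite exponential_martingale// mule1.
  have mexp : measurable_fun setT (fun w => (expR (M c2 n w - A c2 n w / 2))%:E).
    apply/measurable_EFinP; apply: measurableT_comp => //.
    by apply: measurable_funB => //; exact: measurable_funM.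
  rewrite -ge0_integralZl//.
  apply: ge0_le_integral => //.
  + apply/measurable_EFinP; apply: measurable_funX; apply: measurableT_comp => //.
    apply: measurable_funB; first exact: measurable_wrt_fun mM.
    by apply: measurable_funM => //; exact: measurable_wrt_fun mA.
  + exact: measurable_funeM.
  + move=> w _; rewrite -EFinM lee_fin -expRD -expRM_natl ler_expR.
    have AK : A ck n w <= K.
      have [||j [_ _ Aj AjK _]] := @truncated_sums R (c^~ w) (fun=> 0)
        (fun i => tau i.+1 - tau i) K n => //.
        by move=> i ilt; rewrite subr_ge0 tauS.
      by rewrite -Aj in AjK; exact: AjK.
    have -> : M c2 n w = 2 * M ck n w.
      by rewrite /M mulr_sumr; apply: eq_bigr => i _; rewrite mulrA.
    have -> : A c2 n w = 4 * A ck n w.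
      by rewrite /A mulr_sumr; apply: eq_bigr => i _; rewrite /c2; ring.
    lra.
- move=> w; have [||j [jn Mj Aj _ jE]] := @truncated_sums R (c^~ w)
    (fun i => W (tau i.+1) w - W (tau i) w)
    (fun i => tau i.+1 - tau i) K n => //.
    by move=> i ilt; rewrite subr_ge0 tauS.
  exists j; split => //; congr expR; congr (_ - _ / 2); [exact: Mj|exact: Aj].
Qed.

End grid.

End exponential_martingale.

(** * Simple processes restricted to a time interval *)
Section clamp.
Context (R : realType) (s S : R).
Hypothesis sS : s <= S.

(** Moving the times of a simple process into [s, S] restricts the process to
]s, S] without adding grid points. *)
Definition clamp (x : R) := Num.min (Num.max x s) S.

Lemma clamp_ge x : s <= clamp x.
Proof. by rewrite /clamp le_min le_max lexx orbT. Qed.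

Lemma clamp_le x : clamp x <= S.
Proof. by rewrite /clamp ge_min lexx orbT. Qed.

Lemma clamp_mono x y : x <= y -> clamp x <= clamp y.
Proof.
by move=> xy; rewrite /clamp le_min !ge_min lexx orbT andbT ge_max !le_max xy lexx
  orbT.
Qed.

Lemma clamp_big x : S <= x -> clamp x = S.
Proof. by move=> Sx; apply/min_idPr; rewrite le_max Sx. Qed.

Lemma clamp_small x : x <= S -> x <= clamp x.
Proof. by move=> xS; rewrite /clamp le_min le_max lexx. Qed.

Lemma clamp_itv x y : `]x, y] `&` `]s, S] = `]clamp x, clamp y]%classic.
Proof.
apply/seteqP; split=> r /=; rewrite !in_itv/= /clamp gt_min le_min gt_max le_max.
  by move=> [/andP[-> ->] /andP[-> ->]].
move=> /andP[h1 /andP[h2 h3]]; have := h1; rewrite [S < r]ltNge h3 orbF => /andP[-> sr].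
by rewrite sr; move: h2; rewrite [r <= s]leNgt sr orbF => ->.
Qed.

Lemma clamp_minL (w : R -> R) u x : s <= u -> u <= S -> clamp x <= u ->
  w (Num.min x u) - w (Num.min x s) = w (clamp x) - w s.
Proof.
move=> su uS; rewrite /clamp; have [xs|sx] := leP x s.
  by rewrite (min_idPl sS) (min_idPl (le_trans xs su)) !subrr.
have [xS|Sx] := leP x S; first by move/min_idPl ->.
by move=> Su; have -> : u = S by [apply/eqP; rewrite eq_le uS Su]; rewrite (min_idPr (ltW Sx)).
Qed.

Lemma clamp_minR (w : R -> R) u x : s <= u -> u <= S -> u <= clamp x ->
  w (Num.min x u) - w (Num.min x s) = w u - w s.
Proof.
move=> su uS; rewrite /clamp le_min => /andP[+ _]; have [xs|sx] := leP x s.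
  move=> us; have -> : u = s by apply/eqP; rewrite eq_le us su.
  by rewrite (min_idPl xs) !subrr.
by move=> ux; rewrite (min_idPr ux).
Qed.

End clamp.

Section simple_processes.
Context (R : realType) (T : Type) (h : simple_process R T).
Local Notation N := (sp_size h).
Local Notation t := (sp_time h).
Local Notation xi := (sp_coef h).
Hypothesis tS : forall i, (i < N)%N -> t i <= t i.+1.

Let t_mono i j : (i <= j)%N -> (j <= N)%N -> t i <= t j.
Proof.
elim: j => [|j IH]; first by rewrite leqn0 => /eqP->.
rewrite leq_eqVlt => /predU1P[->//|ij] jn.
by rewrite (le_trans (IH ij (ltnW jn)))// tS.
Qed.

(** The first j terms of the restricted process add up to the increment of the
integral from s to any time u of [s, S] that separates the first j + 1 moved
times from the later left end points.  A coefficient whose time exceeds S is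
replaced by 0, since it is not measurable with respect to the past of S; its
increment vanishes. *)
Lemma simple_integral_clamp (W : R -> T -> R) s S u j w : s <= S ->
  s <= u -> u <= S -> (j <= N)%N ->
  (forall i, (i <= j)%N -> clamp s S (t i) <= u) ->
  (forall i, (j <= i)%N -> (i < N)%N ->
     u <= clamp s S (t i)) ->
  \sum_(i < j) (if t i <= S then xi i w else 0) *
     (W (clamp s S (t i.+1)) w - W (clamp s S (t i)) w) =
  simple_integral W h u w - simple_integral W h s w.
Proof.
move=> sS su uS jN lej gej; rewrite /simple_integral -sumrB.
pose f i := xi i w * (W (clamp s S (t i.+1)) w - W (clamp s S (t i)) w).
rewrite [RHS](eq_bigr (fun i : 'I_N => if (i < j)%N then f i else 0)); last first.
  move=> i _; rewrite -mulrBr.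
  rewrite (_ : _ - _ = (W (Num.min (t i.+1) u) w - W (Num.min (t i.+1) s) w) -
    (W (Num.min (t i) u) w - W (Num.min (t i) s) w)); last by ring.
  case: ifPn => [ij|]; last rewrite -leqNgt => ji.
    rewrite !(clamp_minL sS (W^~ w))// ?lej//; last exact: ltnW.
    by rewrite /f; congr (_ * _); ring.
  have ui : u <= clamp s S (t i) by exact: gej.
  rewrite !(clamp_minR (S := S) (W^~ w))// ?subrr ?mulr0//.
  by rewrite (le_trans ui)// clamp_mono// tS.
rewrite -big_mkcond/= -(big_ord_widen_cond _ xpredT)//.
apply: eq_bigr => i _; rewrite /f; case: ifPn => //; rewrite -ltNge => St.
rewrite !clamp_big ?subrr ?mulr0//; first exact: ltW.
by rewrite (le_trans (ltW St))// tS// (leq_trans (ltn_ord i)).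
Qed.

(** The intervals of a simple process are disjoint, so that the cross terms of
the square vanish. *)
Lemma simple_value_sqr r w :
  simple_value h r w ^+ 2 =
  \sum_(i < N) xi i w ^+ 2 * \1_(`]t i, t i.+1]) r.
Proof.
rewrite /simple_value expr2 mulr_suml; apply: eq_bigr => i _.
rewrite !indicE; have [ri|ri] := boolP (r \in _); last first.
  by rewrite !mulr0 mul0r.
rewrite !mulr1 (bigD1 i)//= indicE ri mulr1 big1 ?addr0 ?expr2// => j ji.
rewrite indicE; have [rj|rj] := boolP (r \in _); last by rewrite mulr0.
move: ri rj; rewrite !inE/= !in_itv/= => /andP[ti tiS] /andP[tj tjS].
move: ji; rewrite neq_ltn => /orP[] ij.
- have : t j.+1 <= t i by apply: t_mono => //; exact: ltnW.
  by rewrite leNgt (lt_le_trans ti).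
- have : t i.+1 <= t j by apply: t_mono => //; exact: ltnW.
  by rewrite leNgt (lt_le_trans tj).
Qed.

Lemma integral_simple_sqr s S w : s <= S ->
  (\int[lebesgue_measure]_(r in `]s, S]) (simple_value h r w ^+ 2)%:E =
  (\sum_(i < N) (if t i <= S then xi i w else 0) ^+ 2 *
    (clamp s S (t i.+1) - clamp s S (t i)))%:E)%E.
Proof.
move=> sS.
under eq_integral do rewrite simple_value_sqr -sumEFin.
rewrite ge0_integral_sum//; last 2 first.
- move=> i; apply/measurable_EFinP; apply: measurable_funM => //.
- by move=> i r _; rewrite lee_fin mulr_ge0 ?sqr_ge0.
rewrite -sumEFin; apply: eq_bigr => i _.
under eq_integral do rewrite EFinM.
rewrite ge0_integralZl//; [|exact/measurable_EFinP|by rewrite lee_fin sqr_ge0].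
rewrite integral_indic//= clamp_itv// lebesgue_measure_itv/= lte_fin.
have tiS : t i <= t i.+1 by exact: tS.
have cc := clamp_mono s S tiS.
have -> : (if (clamp s S (t i) < clamp s S (t i.+1))%R then
   (clamp s S (t i.+1))%:E - (clamp s S (t i))%:E else 0)%E =
   (clamp s S (t i.+1) - clamp s S (t i))%:E.
  case: ltP => // cc'; congr EFin; apply/esym/eqP; rewrite subr_eq0 eq_le.
  by rewrite cc cc'.
rewrite -EFinM; congr EFin; case: ifPn => //; rewrite -ltNge => St.
by rewrite !clamp_big ?subrr ?mulr0//; [exact: ltW|rewrite (le_trans (ltW St))].
Qed.

End simple_processes.

(** * Measurability in time and event *)
Section joint_measurability.
Context (R : realType) (d : measure_display) (T : measurableType d)
  (P : probability T R) (W : R -> T -> R).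
Hypothesis hW : brownian_motion P W.
Local Notation F := (augmented_filtration P W).

(** [measurableTypeR R] is the copy of R on which the Lebesgue measure
lives. *)
Definition jointly_measurable (D : set R) (f : R -> T -> R) :=
  @measurable_fun _ _ (measurableTypeR R * T)%type R (D `*` setT)
    (fun p => f p.1 p.2).

Lemma measurable_integral_param (D : set R) (f : R -> T -> R) :
  measurable D -> jointly_measurable D f -> (forall r w, 0 <= f r w) ->
  measurable_fun setT (fun w => \int[@lebesgue_measure R]_(r in D) (f r w)%:E)%E.
Proof.
move=> mD mf f0.
have mDT : measurable (D `*` setT : set (measurableTypeR R * T)).
  exact: measurableX.
pose g := (fun p : measurableTypeR R * T => (f p.1 p.2)%:E) \_ (D `*` setT).
have mg : measurable_fun setT g.
  by apply/(measurable_restrictT _ mDT); exact/measurable_EFinP.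
have g0 p : (0 <= g p)%E by rewrite /g patchE; case: ifP => // _; rewrite lee_fin.
have := @measurable_fun_fubini_tonelli_G _ _ (measurableTypeR R) T R
  (@lebesgue_measure R) g mg g0.
apply: eq_measurable_fun => w _; rewrite /fubini_G [in RHS]integral_mkcond.
apply: eq_integral => r _; rewrite /g !patchE.
by congr (if _ then _ else _); apply/idP/idP; rewrite !inE/=; [case|].
Qed.

Lemma progressive_jointly_measurable (H : R -> T -> R) (t : R) : 0 <= t ->
  progressively_measurable F H -> jointly_measurable `[0, t] H.
Proof.
move=> t0 pH _ B mB; have := pH t t0 B mB.
rewrite [X in measurable X](_ : _ = [set p | 0 <= p.1 <= t /\ B (H p.1 p.2)]).
  apply: smallest_sub; first exact: sigma_algebra_measurable.
  move=> _ [A mA [D FD <-]]; apply: measurableX => //.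
  by apply: (augmented_filtration_sub hW); exact: FD.
by apply/seteqP; split=> -[r w]/=; rewrite in_itv/=; [move=> [[] ] | move=> []].
Qed.

Lemma simple_jointly_measurable (h : simple_process R T) (D : set R) :
  measurable D -> simple_adapted F h ->
  jointly_measurable D (simple_value h).
Proof.
move=> mD ah; apply: measurable_funTS; apply: measurable_sum => i.
have [_ _ mxi _] := ah i (ltn_ord i).
apply: measurable_funM; apply: measurableT_comp => //.
exact: measurable_wrt_fun mxi.
Qed.

End joint_measurability.

(** * Dyadic times and suprema of continuous paths *)
Section dyadic.
Context (R : realType).
Implicit Types (t : R) (n : nat).

Definition dyadic n k : R := k%:R / 2 ^+ n.

Lemma dyadic_ge0 n k : 0 <= dyadic n k.
Proof. by rewrite /dyadic divr_ge0. Qed.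

Lemma dyadic_truncn_le t n : 0 <= t -> dyadic n (Num.truncn (t * 2 ^+ n)) <= t.
Proof.
move=> t0; rewrite /dyadic ler_pdivrMr ?exprn_gt0//.
by rewrite Num.Theory.truncn_le mulr_ge0// exprn_ge0.
Qed.

Lemma dyadic_truncn_gt t n : 0 <= t ->
  t - (2 ^+ n)^-1 < dyadic n (Num.truncn (t * 2 ^+ n)).
Proof.
move=> t0; rewrite /dyadic ltr_pdivlMr ?exprn_gt0//.
rewrite mulrBl mulVf ?expf_neq0// ltrBlDr.
by rewrite natr1; apply: Num.Theory.truncnS_gt.
Qed.

Lemma within_continuous_gt (f : R -> R) t c : {within `[0, +oo[, continuous f} ->
  0 <= t -> c < f t ->
  exists2 e, 0 < e & forall u, 0 <= u -> `|t - u| < e -> c < f u.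
Proof.
move=> /subspace_continuousP cf t0 cft.
have := cf t; rewrite /= in_itv/= t0 => /(_ isT) /cvgr_gt /(_ _ cft).
rewrite near_withinE => /nbhs_ballP[e e0 He]; exists e => // u u0 tu.
by apply: He => //=; rewrite in_itv/= u0.
Qed.

Lemma dyadic_eventually_gt (f : R -> R) t c : {within `[0, +oo[, continuous f} ->
  0 <= t -> c < f t ->
  \forall n \near \oo, c < f (dyadic n (Num.truncn (t * 2 ^+ n))) .
Proof.
move=> cf t0 cft; have [e e0 He] := within_continuous_gt cf t0 cft.
have : \forall n \near \oo, ((2 : R) ^- n) < e.
  have : ((2 : R)^-1) ^+ n @[n --> \oo] --> 0.
    by apply: cvg_expr; rewrite gtr0_norm// invf_lt1// ltr1n.
  by move=> /cvgr_lt /(_ _ e0); apply: filterS => n; rewrite exprVn.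
apply: filterS => n ne; apply: He; first exact: dyadic_ge0.
rewrite ger0_norm ?subr_ge0 ?dyadic_truncn_le//.
by rewrite ltrBlDr -ltrBlDl (le_lt_trans _ (dyadic_truncn_gt n t0))// lerB// ltW.
Qed.

End dyadic.

Section sup_event.
Context (R : realType) (d : measure_display) (T : measurableType d).

(** By continuity the supremum over [0, S] is approached along dyadic times,
and rounding down keeps these times in [0, S]. *)
Lemma measurable_sup_event (f : R -> T -> R) (S eps : R) :
  continuous_paths f -> (forall t, 0 <= t -> measurable_fun setT (f t)) ->
  measurable
    [set w | (eps%:E <= ereal_sup [set (f t w)%:E | t in `[0%R, S]])%E].
Proof.
move=> cf mf.
have -> : [set w | (eps%:E <= ereal_sup [set (f t w)%:E | t in `[0%R, S]])%E] =
    \bigcap_m \bigcup_n \bigcup_k [set w | (dyadic R n k <= S) /\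
      eps - m.+1%:R^-1 < f (dyadic R n k) w].
  apply/seteqP; split => w /=.
    move=> epsS m mI; have : ((eps - m.+1%:R^-1)%:E <
        ereal_sup [set (f t w)%:E | t in `[0%R, S]])%E.
      by apply: lt_le_trans epsS; rewrite lte_fin ltrBlDr ltrDl invr_gt0.
    move=> /ereal_sup_gt[_ [t /= + <-]]; rewrite in_itv/= => /andP[t0 tS].
    rewrite lte_fin => /(dyadic_eventually_gt (cf w) t0)[n _ /(_ n (leqnn n)) h].
    exists n => //; exists (Num.truncn (t * 2 ^+ n)) => //=; split => //.
    by rewrite (le_trans _ tS)// dyadic_truncn_le.
  move=> h; apply/lee_addgt0Pr => e e0.
  have [m me] : exists m, m.+1%:R^-1 < e.
    by have [m _ /(_ m (leqnn m))] := near_infty_natSinv_lt (PosNum e0); exists m.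
  have [n _ [k _ [kS fk]]] := h m I.
  apply: (@le_trans _ _ ((f (dyadic R n k) w)%:E + e%:E)%E).
    by rewrite -EFinD lee_fin -lerBlDr (le_trans _ (ltW fk))// lerB// ltW.
  rewrite leeD2r//; apply: ereal_sup_ubound; exists (dyadic R n k) => //=.
  by rewrite in_itv/= dyadic_ge0.
apply: bigcapT_measurable => m; apply: bigcupT_measurable => n.
apply: bigcupT_measurable => k; have [kS|kS] := leP (dyadic R n k) S; last first.
  by rewrite (_ : mkset _ = set0)// -subset0 => w [].
rewrite (_ : mkset _ = setT `&` f (dyadic R n k) @^-1` `]eps - m.+1%:R^-1, +oo[).
  by apply: mf => //; exact: dyadic_ge0.
by rewrite setTI; apply/seteqP; split => w /=; rewrite in_itv/= andbT; [case|].
Qed.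

Lemma sup_event_lt (f : R -> T -> R) (S eps : R) w :
  ~ (eps%:E <= ereal_sup [set (f t w)%:E | t in `[0%R, S]])%E ->
  forall t, 0 <= t -> t <= S -> f t w < eps.
Proof.
move=> /negP; rewrite -ltNge => h t t0 tS; rewrite -lte_fin.
apply: le_lt_trans h; apply: ereal_sup_ubound; exists t => //=.
by rewrite in_itv/= t0.
Qed.

Lemma within_continuous_min (f : R -> R) a : 0 <= a ->
  {within `[0, +oo[, continuous f} ->
  {within `[0, +oo[, continuous (fun t => f (Num.min a t))}.
Proof.
move=> a0 /subspace_continuousP cf; apply/subspace_continuousP => x x0.
have ax0 : `[0, +oo[%classic (Num.min a x).
  by move: x0; rewrite /= !in_itv/= !andbT le_min a0.
have cm : {for x, continuous (fun t => Num.min a t)}.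
  by apply: (@continuous_min R R (cst a) id x) => //; exact: cvg_cst.
apply: (cvg_comp (fun t => Num.min a t) f _ (cf _ ax0)).
move=> U /= [e e0 He].
have := cm _ (nbhsx_ballx _ _ e0).
rewrite /= !nbhs_simpl/=.
apply: filterS => u au u0; apply: He => //.
by move: u0; rewrite /= !in_itv/= !andbT le_min a0.
Qed.

Lemma simple_integral_continuous (W : R -> T -> R) (h : simple_process R T) :
  continuous_paths W ->
  (forall i, (i < sp_size h)%N -> 0 <= sp_time h i /\ 0 <= sp_time h i.+1) ->
  continuous_paths (simple_integral W h).
Proof.
move=> cW t0 w; rewrite /simple_integral.
apply: (@continuous_big R^o 'I_(sp_size h) +%R 0 xpredT (@add_continuous R^o)
  (subspace `[0 : R, +oo[) (index_enum _)).
move=> i _ x; apply: (@cvgM R _ (nbhs x)); first exact: cvg_cst.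
have [ti0 tS0] := t0 i (ltn_ord i).
by apply: (@cvgB R R^o); exact: within_continuous_min (cW w) _.
Qed.

End sup_event.

(** * Stopped exponentials of simple integrals *)
Section stopped_simple_processes.
Context (R : realType) (d : measure_display) (T : measurableType d)
  (P : probability T R) (W : R -> T -> R).
Hypothesis hW : brownian_motion P W.
Local Notation F := (augmented_filtration P W).

(** X is the exponential martingale of lam 1_B h on ]s, S], switched off at
energy K.  Wherever it stops, it is at most the exponential of the integral up
to some time u of [s, S]; where the total energy is at most K, it has its
terminal value. *)
Lemma simple_stopped (h : simple_process R T) (s S lam K : R) (B : set T) :
  simple_adapted F h -> 0 <= s -> s <= S -> F s B -> 0 <= K ->
  exists X : T -> R, [/\ measurable_fun setT X /\ (forall w, 0 <= X w),
    (\int[P]_w (X w)%:E = 1)%E,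
    (\int[P]_w (X w ^+ 2)%:E <= (expR K)%:E)%E,
    forall w, exists u, [/\ s <= u, u <= S &
      X w <= expR (lam * \1_B w * (simple_integral W h u w - simple_integral W h s w))] &
    forall w q,
      (\int[lebesgue_measure]_(r in `]s, S]) (simple_value h r w ^+ 2)%:E = q%:E)%E ->
      lam ^+ 2 * \1_B w * q <= K ->
      X w = expR (lam * \1_B w * (simple_integral W h S w - simple_integral W h s w)
                  - lam ^+ 2 * \1_B w * q / 2)].
Proof.
move=> ah s0 sS FB K0.
pose N := sp_size h; pose t := sp_time h; pose xi := sp_coef h.
pose tau i := clamp s S (t i).
pose c0 i w := if t i <= S then xi i w else 0.
pose c i w := lam * \1_B w * c0 i w.
have tS i : (i < N)%N -> t i <= t i.+1 by move=> /ah[].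
have tau0 : 0 <= tau 0%N by rewrite (le_trans s0)// clamp_ge.
have tauS i : (i < N)%N -> tau i <= tau i.+1.
  by move=> /tS tiS; exact: clamp_mono.
have mc i : (i < N)%N -> measurable_wrt (F (tau i)) (c i).
  move=> iN; apply/measurable_wrtP; apply: measurable_funM.
    apply: measurable_funM => //; apply: measurable_indic.
    by apply: (augmented_filtration_mono (clamp_ge sS (t i))); exact: FB.
  have -> : c0 i = if t i <= S then xi i else cst 0.
    by apply/funext => w; rewrite /c0; case: ifP.
  case: ifPn => tiS; last exact: measurable_cst.
  have [_ _ mxi _] := ah i iN; apply/measurable_wrtP.
  by apply: measurable_wrt_mono mxi; exact: clamp_small.
have indic_sqr w : (\1_B w : R) ^+ 2 = \1_B w.
  by rewrite indicE; case: (_ \in _); rewrite ?expr1n ?expr0n.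
have [X [mX X1 X2 HX]] := stopped_exponential hW tau0 tauS mc K0.
have ME j w : \sum_(i < j) c i w * (W (tau i.+1) w - W (tau i) w) =
    lam * \1_B w * \sum_(i < j) c0 i w * (W (tau i.+1) w - W (tau i) w).
  by rewrite mulr_sumr; apply: eq_bigr => i _; rewrite /c mulrA.
have AE j w : \sum_(i < j) c i w ^+ 2 * (tau i.+1 - tau i) =
    lam ^+ 2 * \1_B w * \sum_(i < j) c0 i w ^+ 2 * (tau i.+1 - tau i).
  rewrite mulr_sumr; apply: eq_bigr => i _.
  by rewrite /c !exprMn indic_sqr; ring.
have MN w : \sum_(i < N) c0 i w * (W (tau i.+1) w - W (tau i) w) =
    simple_integral W h S w - simple_integral W h s w.
  apply: simple_integral_clamp => // [i _|i Ni]; first exact: clamp_le.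
  by rewrite ltnNge Ni.
exists X; split => //.
- by split => // w; have [j [_ -> _]] := HX w; exact: expR_ge0.
- move=> w; have [j [jN -> _]] := HX w.
  have A0 : 0 <= \sum_(i < j) c i w ^+ 2 * (tau i.+1 - tau i).
    apply: sumr_ge0 => i _; rewrite mulr_ge0 ?sqr_ge0// subr_ge0 tauS//.
    by rewrite (leq_trans (ltn_ord i)).
  have le1 u : \sum_(i < j) c0 i w * (W (tau i.+1) w - W (tau i) w) =
      simple_integral W h u w - simple_integral W h s w ->
      expR (\sum_(i < j) c i w * (W (tau i.+1) w - W (tau i) w) -
            (\sum_(i < j) c i w ^+ 2 * (tau i.+1 - tau i)) / 2) <=
      expR (lam * \1_B w * (simple_integral W h u w - simple_integral W h s w)).
    by move=> <-; rewrite ler_expR ME gerBl divr_ge0.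
  have := jN; rewrite leq_eqVlt => /predU1P[jE|jlt].
    by exists S; split => //; apply: le1; rewrite jE MN.
  have tau_mono i k : (i <= k)%N -> (k <= N)%N -> tau i <= tau k.
    elim: k => [|k IH]; first by rewrite leqn0 => /eqP->.
    rewrite leq_eqVlt => /predU1P[->//|ik] kN.
    by rewrite (le_trans (IH ik (ltnW kN)))// tauS.
  exists (tau j); split; [exact: clamp_ge|exact: clamp_le|apply: le1].
  apply: simple_integral_clamp => //; [exact: clamp_ge|exact: clamp_le| |].
    by move=> i ij; exact: tau_mono.
  by move=> i ji iN; apply: tau_mono => //; exact: ltnW.
- move=> w q qE qK; have [j [jN -> jK]] := HX w.
  have qE' : q = \sum_(i < N) c0 i w ^+ 2 * (tau i.+1 - tau i).
    by move: qE; rewrite integral_simple_sqr// => -[<-].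
  rewrite jK; last by rewrite AE -qE'.
  by rewrite ME MN AE -qE'.
Qed.

End stopped_simple_processes.

(** * Passage to the limit in the exponential *)
Lemma cvge0_lt (R : realType) (u : (\bar R)^nat) (x : R) :
  u n @[n --> \oo] --> 0%E -> 0 < x -> \forall n \near \oo, (u n < x%:E)%E.
Proof.
move=> cu x0; have x0' : (0 < x%:E)%E by rewrite lte_fin.
exact: (cu _ (open_ereal_lt' x0')).
Qed.

(** From f^2 <= 2 g^2 + 2 (f - g)^2.  The factor 2 is what turns the 1/2 of
the exponential martingale into the 1/4 of [exp_integral]. *)
Lemma ge0_integral_sqr_le (R : realType) (D : set R) (f g : R -> R) :
  measurable D -> measurable_fun D f -> measurable_fun D g ->
  (\int[lebesgue_measure]_(r in D) (f r ^+ 2)%:E <=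
   2%:E * \int[lebesgue_measure]_(r in D) (g r ^+ 2)%:E +
   2%:E * \int[lebesgue_measure]_(r in D) ((f r - g r) ^+ 2)%:E)%E.
Proof.
move=> mD mf mg.
have mf2 : measurable_fun D (fun r => (f r ^+ 2)%:E).
  by apply/measurable_EFinP; exact: measurable_funX.
have mg2 : measurable_fun D (fun r => (g r ^+ 2)%:E).
  by apply/measurable_EFinP; exact: measurable_funX.
have mfg : measurable_fun D (fun r => ((f r - g r) ^+ 2)%:E).
  by apply/measurable_EFinP; apply: measurable_funX; exact: measurable_funB.
have m2g := measurable_funeM 2%:E mg2; have m2fg := measurable_funeM 2%:E mfg.
have sq0 (x : R) : (0 <= 2%:E * (x ^+ 2)%:E)%E.
  by rewrite -EFinM lee_fin mulr_ge0 ?sqr_ge0.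
have sq0' (x : R) : (0 <= (x ^+ 2)%:E)%E by rewrite lee_fin sqr_ge0.
rewrite -!ge0_integralZl// -ge0_integralD//.
apply: ge0_le_integral => //; first exact: emeasurable_funD.
move=> r _; rewrite -!EFinM -EFinD lee_fin.
have := sqr_ge0 (f r - 2 * g r); lra.
Qed.

Lemma section_measurable (R : realType) (d : measure_display)
    (T : measurableType d) (D : set R) (f : R -> T -> R) w :
  measurable D -> jointly_measurable D f -> measurable_fun D (f^~ w).
Proof.
move=> mD mf _ B mB.
have mDT : measurable (D `*` setT : set (measurableTypeR R * T)).
  exact: measurableX.
have := measurable_ysection w (mf mDT B mB).
by congr (measurable _); apply/seteqP; split=> r; rewrite /ysection/= inE/=; tauto.
Qed.

Section integral_limit.
Context (R : realType) (d : measure_display) (T : measurableType d)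
  (P : probability T R) (W : R -> T -> R).
Hypothesis hW : brownian_motion P W.
Local Notation F := (augmented_filtration P W).

Variables (H I : R -> T -> R).
Hypothesis hI : ito_integral P F W H I.
Variables (s S lam c : R) (B : set T).
Hypotheses (s0 : 0 <= s) (sS : s <= S) (FB : F s B).
Hypothesis I_bounded : {ae P, forall w, forall t u, 0 <= t -> 0 <= u ->
  `|I t w - I u w| <= c}.

Let A w : \bar R := (\int[lebesgue_measure]_(r in `]s, S]) (H r w ^+ 2)%:E)%E.
Let a w : R := fine (A w).

Definition exp_integral w :=
  expR (lam * \1_B w * (I S w - I s w) - lam ^+ 2 * \1_B w * a w / 4).

Let S0 : 0 <= S. Proof. exact: le_trans sS. Qed.

Let sub_itv : `]s, S] `<=` `[0, S].
Proof.
by move=> r /=; rewrite !in_itv/= => /andP[sr ->]; rewrite (le_trans s0)// ltW.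
Qed.

Let jH : jointly_measurable `[0, S] H.
Proof.
by have [[pH _] _ _ _] := hI; exact: (progressive_jointly_measurable hW).
Qed.

Let jH' : jointly_measurable `]s, S] H.
Proof.
apply: measurable_funS jH; first exact: measurableX.
by move=> [r w] [/= /sub_itv].
Qed.

Let mI t : 0 <= t -> measurable_fun setT (I t).
Proof. by move=> t0; have [_ aI _ _] := hI; apply: (measurable_wrt_fun hW (aI t _)). Qed.

Let mA : measurable_fun setT A.
Proof.
apply: (measurable_integral_param (f := fun r w => H r w ^+ 2)) => //.
  exact: measurable_funX.
by move=> r w; exact: sqr_ge0.
Qed.

Let A_ge0 w : (0 <= A w)%E.
Proof. by apply: integral_ge0 => r _; rewrite lee_fin sqr_ge0. Qed.

Let A_fin : {ae P, forall w, (A w < +oo)%E}.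
Proof.
have [[_ /(_ S S0) Hfin] _ _ _] := hI; apply: filterS Hfin => w Hw.
refine (@le_lt_trans _ _ _ _ _ _ Hw); apply: ge0_subset_integral => //.
- by apply/measurable_EFinP/measurable_funX; exact: (section_measurable _ _ jH).
- by move=> r _; rewrite lee_fin sqr_ge0.
Qed.

Let mB : measurable B. Proof. exact: (augmented_filtration_sub hW) FB. Qed.

Lemma measurable_exp_integral : measurable_fun setT exp_integral.
Proof.
apply: measurableT_comp => //; apply: measurable_funB.
  apply: measurable_funM.
    by apply: measurable_funM => //; exact: measurable_indic.
  by apply: measurable_funB; exact: mI.
apply: measurable_funM => //; apply: measurable_funM.
  by apply: measurable_funM => //; exact: measurable_indic.
exact: measurableT_comp.
Qed.

(** The energy is almost surely finite, which is all that is known of it: the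
level at which integrands are switched off is chosen from this limit. *)
Lemma large_energy_cvg0 :
  P [set w | (m%:R%:E <= A w)%E] @[m --> \oo] --> 0%E.
Proof.
have mAm m : measurable [set w | (m%:R%:E <= A w)%E].
  by rewrite -[X in measurable X]setTI; exact: emeasurable_fun_c_infty.
have mAI : measurable (\bigcap_m [set w | (m%:R%:E <= A w)%E]).
  exact: bigcapT_measurable.
have <- : P (\bigcap_m [set w | (m%:R%:E <= A w)%E]) = 0%E.
  have [N [mN PN AN]] := A_fin.
  apply/eqP; rewrite -measure_le0 -PN; apply: le_measure; rewrite ?inE//.
  move=> w Aw; apply: AN => /= Awoo.
  have Awr : A w = (a w)%:E by rewrite fineK// ge0_fin_numE.
  have := Aw (Num.truncn (a w)).+1 Logic.I; rewrite /= Awr lee_fin leNgt.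
  by rewrite truncnS_gt.
apply: (@nonincreasing_cvg_mu _ _ _ P (fun m => [set w | (m%:R%:E <= A w)%E])) => //.
- by rewrite -ge0_fin_numE// fin_num_measure.
- move=> m n mn; apply/subsetPset => w /=; apply: le_trans.
  by rewrite lee_fin ler_nat.
Qed.


Let sup_err (h : simple_process R T) w : \bar R :=
  ereal_sup [set (`|simple_integral W h t w - I t w|)%:E | t in `[0, S]].
Let sqr_err (h : simple_process R T) w : \bar R :=
  (\int[@lebesgue_measure R]_(r in `[0%R, S])
     ((simple_value h r w - H r w) ^+ 2)%:E)%E.

Lemma measurable_sup_err h eps : simple_adapted F h ->
  measurable [set w | (eps%:E <= sup_err h w)%E].
Proof.
move=> ah; have [_ cW _ _ _] := hW; have [_ _ cI _] := hI.
have t0 i : (i < sp_size h)%N -> 0 <= sp_time h i /\ 0 <= sp_time h i.+1.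
  by move=> /ah[t0 tS _ _]; split => //; exact: le_trans tS.
apply: (measurable_sup_event (f := fun t w => `|simple_integral W h t w - I t w|)).
  move=> w x; apply: (@cvg_norm R R^o); apply: (@cvgB R R^o); last exact: cI.
  exact: (simple_integral_continuous cW t0).
move=> t t0'; apply: measurableT_comp => //; apply: measurable_funB; last exact: mI.
apply: measurable_sum => i; have [ti0 tS0] := t0 i (ltn_ord i).
have [_ _ mxi _] := ah i (ltn_ord i).
apply: measurable_funM; first exact: measurable_wrt_fun mxi.
by apply: measurable_funB; apply: (brownian_measurable hW);
  rewrite le_min ?ti0 ?tS0 t0'.
Qed.

Let jh h : simple_adapted F h -> jointly_measurable `[0, S] (simple_value h).
Proof. by move=> ah; exact: (simple_jointly_measurable hW). Qed.

Lemma measurable_sqr_err h : simple_adapted F h -> measurable_fun setT (sqr_err h).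
Proof.
move=> ah; apply: (measurable_integral_param
  (f := fun r w => (simple_value h r w - H r w) ^+ 2)) => //.
  by apply: measurable_funX; apply: measurable_funB; [exact: jh|exact: jH].
by move=> r w; exact: sqr_ge0.
Qed.

Lemma energy_comparison h w eps : simple_adapted F h -> (A w < +oo)%E ->
  (sqr_err h w < eps%:E)%E ->
  exists q, [/\ (\int[lebesgue_measure]_(r in `]s, S]) (simple_value h r w ^+ 2)%:E
    = q%:E)%E, q <= 2 * a w + 2 * eps & a w <= 2 * q + 2 * eps].
Proof.
move=> ah Aoo Deps.
have mhS : measurable_fun `[0, S] (fun r => simple_value h r w).
  exact: (section_measurable _ _ (jh ah)).
have mHS : measurable_fun `[0, S] (fun r => H r w).
  exact: (section_measurable _ _ jH).
have mh : measurable_fun `]s, S] (fun r => simple_value h r w).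
  exact: measurable_funS mhS.
have mH : measurable_fun `]s, S] (fun r => H r w) by exact: measurable_funS mHS.
have D1 : (\int[@lebesgue_measure R]_(r in `]s, S])
    ((simple_value h r w - H r w) ^+ 2)%:E <= sqr_err h w)%E.
  apply: ge0_subset_integral => //.
  - by apply/measurable_EFinP; apply: measurable_funX; exact: measurable_funB.
  - by move=> r _; rewrite lee_fin sqr_ge0.
have D2 : (\int[@lebesgue_measure R]_(r in `]s, S])
    ((H r w - simple_value h r w) ^+ 2)%:E <= sqr_err h w)%E.
  by under eq_integral do rewrite -sqrrN opprB.
have AE : A w = (a w)%:E by rewrite fineK// ge0_fin_numE.
have D0 : (0 <= sqr_err h w)%E.
  by apply: integral_ge0 => r _; rewrite lee_fin sqr_ge0.
have DE : sqr_err h w = (fine (sqr_err h w))%:E.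
  by rewrite fineK// ge0_fin_numE// (lt_trans Deps)// ltry.
set Q := (\int[lebesgue_measure]_(r in `]s, S]) (simple_value h r w ^+ 2)%:E)%E.
have Q0 : (0 <= Q)%E by apply: integral_ge0 => r _; rewrite lee_fin sqr_ge0.
have QA : (Q <= 2%:E * A w + 2%:E * sqr_err h w)%E.
  apply: le_trans (ge0_integral_sqr_le _ mh mH) _ => //.
  by rewrite leeD2l// lee_pmul2l.
have AQ : (A w <= 2%:E * Q + 2%:E * sqr_err h w)%E.
  apply: le_trans (ge0_integral_sqr_le _ mH mh) _ => //.
  by rewrite leeD2l// lee_pmul2l.
have Qoo : (Q < +oo)%E.
  by apply: le_lt_trans QA _; rewrite AE DE -!EFinM -EFinD ltry.
have QE : Q = (fine Q)%:E by rewrite fineK// ge0_fin_numE.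
move: Deps QA AQ; rewrite AE DE QE -!EFinM -!EFinD !lee_fin lte_fin => Deps QA AQ.
exists (fine Q); split => //.
- by rewrite (le_trans QA)// lerD2l ler_pM2l// ltW.
- by rewrite (le_trans AQ)// lerD2l ler_pM2l// ltW.
Qed.

(** Three bad events: the simple integral is far from I, the integrand is far
in energy, the energy of H is at least m.  Off the three, h is not switched off
and X is at most the limiting exponential, up to the first factor.  If only the
first is avoided, then X is at most C, because the increments of I are bounded.
On the first, x <= (dl x^2 + 1 / dl) / 2 leaves X to its second moment. *)
Lemma exp_integral_pointwise h (X : T -> R) (eps C dl : R) m w :
  simple_adapted F h -> 0 < eps -> eps <= 1 -> 0 < dl ->
  C = expR (`|lam| * (2 + c)) ->
  (forall t u, 0 <= t -> 0 <= u -> `|I t w - I u w| <= c) ->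
  (A w < +oo)%E -> 0 <= X w ->
  (exists u, [/\ s <= u, u <= S &
     X w <= expR (lam * \1_B w * (simple_integral W h u w - simple_integral W h s w))]) ->
  (forall q,
      (\int[lebesgue_measure]_(r in `]s, S]) (simple_value h r w ^+ 2)%:E = q%:E)%E ->
      lam ^+ 2 * \1_B w * q <= lam ^+ 2 * (2 * m%:R + 2) ->
      X w = expR (lam * \1_B w * (simple_integral W h S w - simple_integral W h s w)
                  - lam ^+ 2 * \1_B w * q / 2)) ->
  X w <= expR ((2 * `|lam| + lam ^+ 2 / 2) * eps) * exp_integral w +
    C * \1_[set w | (eps%:E <= sqr_err h w)%E] w +
    C * \1_[set w | (m%:R%:E <= A w)%E] w +
    (dl / 2 * X w ^+ 2 + (2 * dl)^-1 * \1_[set w | (eps%:E <= sup_err h w)%E] w).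
Proof.
move=> ah eps0 eps1 dl0 CE Ic Aoo X0 [u [su uS Xu]] XS.
set G2 := [set w | (eps%:E <= sqr_err h w)%E].
set G3 := [set w | (m%:R%:E <= A w)%E].
set G1 := [set w | (eps%:E <= sup_err h w)%E].
have C0 : 0 < C by rewrite CE expR_gt0.
have indic01 (G : set T) : (\1_G w : R) = 1 /\ G w \/ (\1_G w : R) = 0 /\ ~ G w.
  rewrite indicE; have [wG|wG] := pselect (G w).
    by left; rewrite mem_set.
  by right; rewrite memNset.
have e0 : 0 <= expR ((2 * `|lam| + lam ^+ 2 / 2) * eps) * exp_integral w.
  by rewrite mulr_ge0// expR_ge0.
have dlX : 0 <= dl / 2 * X w ^+ 2 by rewrite mulr_ge0 ?sqr_ge0// divr_ge0// ltW.
have dli : 0 < (2 * dl)^-1 by rewrite invr_gt0 mulr_gt0.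
have [[G1w _]|[G1w nG1]] := indic01 G1.
  have amgm : X w <= dl / 2 * X w ^+ 2 + (2 * dl)^-1.
    rewrite -subr_ge0.
    rewrite (_ : _ - _ = (2 * dl)^-1 * (dl * X w - 1) ^+ 2).
      by rewrite mulr_ge0 ?sqr_ge0// ltW.
    by field; rewrite gt_eqF.
  have [[-> _]|[-> _]] := indic01 G2; have [[-> _]|[-> _]] := indic01 G3;
    rewrite G1w; lra.
have Jerr t : 0 <= t -> t <= S -> `|simple_integral W h t w - I t w| < eps.
  by move=> t0 tS; exact: (sup_event_lt
    (f := fun t w => `|simple_integral W h t w - I t w|) nG1).
have u0 := le_trans s0 su.
have lamB : `|lam * \1_B w| <= `|lam|.
  rewrite normrM ler_piMr//.
  by have [[-> _]|[-> _]] := indic01 B; rewrite ?normr1 ?normr0.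
have XC : X w <= C.
  apply: le_trans Xu _; rewrite CE ler_expR.
  apply: le_trans (ler_norm _) _; rewrite normrM ler_pM//.
  rewrite (_ : _ - _ = (simple_integral W h u w - I u w) + (I u w - I s w) -
    (simple_integral W h s w - I s w)); last by ring.
  apply: le_trans (ler_normB _ _) _.
  have J1 := Jerr u u0 uS; have J2 := Jerr s s0 sS.
  have J3 := ler_normD (simple_integral W h u w - I u w) (I u w - I s w).
  have J4 := Ic u s u0 s0; lra.
have [[G2w _]|[G2w nG2]] := indic01 G2.
  by have [[-> _]|[-> _]] := indic01 G3; rewrite G1w G2w; lra.
have [[G3w _]|[G3w nG3]] := indic01 G3; first by rewrite G1w G2w G3w; lra.
rewrite G1w G2w G3w !mulr0 !addr0.
apply: (@le_trans _ _ (expR ((2 * `|lam| + lam ^+ 2 / 2) * eps) * exp_integral w)); last lra.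
move/negP: nG2; rewrite -ltNge => Deps.
move/negP: nG3; rewrite -ltNge => Am.
have [q [qE qA Aq]] := energy_comparison ah Aoo Deps.
have q0 : 0 <= q.
  by rewrite -lee_fin -qE; apply: integral_ge0 => r _; rewrite lee_fin sqr_ge0.
have am : a w < m%:R.
  by rewrite -lte_fin fineK// ge0_fin_numE.
have B01 : 0 <= (\1_B w : R) <= 1.
  by have [[-> _]|[-> _]] := indic01 B; rewrite lexx ler01.
rewrite (XS q qE); last first.
  rewrite -mulrA ler_wpM2l ?sqr_ge0//.
  have /andP[B0 B1] := B01.
  apply: (@le_trans _ _ q); last lra.
  by rewrite ler_piMl.
rewrite -expRD ler_expR.
have J1 := Jerr S S0 (lexx S); have J2 := Jerr s s0 sS.
have h1 : lam * \1_B w * (simple_integral W h S w - simple_integral W h s w) <=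
   lam * \1_B w * (I S w - I s w) + 2 * `|lam| * eps.
  rewrite -lerBlDl -mulrBr; apply: le_trans (ler_norm _) _; rewrite normrM.
  rewrite (mulrC 2) -mulrA ler_pM//.
  rewrite (_ : _ - _ = (simple_integral W h S w - I S w) -
    (simple_integral W h s w - I s w)); last by ring.
  by apply: le_trans (ler_normB _ _) _; lra.
have h2 : - (lam ^+ 2 * \1_B w * q / 2) <=
    - (lam ^+ 2 * \1_B w * a w / 4) + lam ^+ 2 / 2 * eps.
  have /andP[B0 B1] := B01; have l0 := sqr_ge0 lam.
  have h3 : lam ^+ 2 * \1_B w * a w <= lam ^+ 2 * \1_B w * (2 * q + 2 * eps).
    by rewrite ler_wpM2l// mulr_ge0.
  have h4 : lam ^+ 2 * \1_B w * eps <= lam ^+ 2 * eps.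
    by rewrite ler_wpM2r ?(ltW eps0)// ler_piMr.
  lra.
lra.
Qed.

(** Integrating the pointwise bound.  Each of the three error terms is made at
most eta. *)
Lemma exp_integral_approx eta : 0 < eta -> eta <= 1 ->
  (1 <= (1 + eta)%:E * \int[P]_w (exp_integral w)%:E + (3 * eta)%:E)%E.
Proof.
move=> eta0 eta1.
pose C := expR (`|lam| * (2 + c)).
have C0 : 0 < C by exact: expR_gt0.
pose kappa := 2 * `|lam| + lam ^+ 2 / 2.
have kappa0 : 0 <= kappa.
  by rewrite /kappa; have := sqr_ge0 lam; have := normr_ge0 lam; lra.
have kappa1 : 0 < kappa + 1 by rewrite ltr_pwDr.
have ln0 : 0 < ln (1 + eta) by rewrite ln_gt0// ltrDl.
(* the parameters are chosen in this order: eps, the energy level m, the weight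
   dl of the second moment, and last the index n of the approximation *)
pose eps := Num.min 1 (ln (1 + eta) / (kappa + 1)).
have eps0 : 0 < eps by rewrite lt_min ltr01 divr_gt0.
have eps1 : eps <= 1 by rewrite ge_min lexx.
have kappaE : expR (kappa * eps) <= 1 + eta.
  rewrite -[leRHS]lnK ?posrE ?addr_gt0// ler_expR.
  apply: (@le_trans _ _ ((kappa + 1) * eps)); first by rewrite ler_pM2r// lerDl.
  by rewrite mulrC -ler_pdivlMr// ge_min lexx orbT.
have etaC : 0 < eta / C by rewrite divr_gt0.
have [m _ /(_ m (leqnn m)) G3m] := cvge0_lt large_energy_cvg0 etaC.
pose K := lam ^+ 2 * (2 * m%:R + 2).
have K0 : 0 <= K by rewrite mulr_ge0 ?sqr_ge0// addr_ge0.
pose dl := eta / expR K.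
have dl0 : 0 < dl by rewrite divr_gt0 ?expR_gt0.
have dleta : 0 < dl * eta by rewrite mulr_gt0.
have [_ _ _ /(_ S S0)[h [ah hD hS]]] := hI.
have [n _ /(_ n (leqnn n))[G2n G1n]] := filterI (cvge0_lt (hD eps eps0) etaC)
  (cvge0_lt (hS eps eps0) dleta).
have [X [[mX X0] X1 X2 Xu XS]] :=
  simple_stopped hW lam (ah n) s0 sS FB K0.
pose G2 := [set w | (eps%:E <= sqr_err (h n) w)%E].
pose G3 := [set w | (m%:R%:E <= A w)%E].
pose G1 := [set w | (eps%:E <= sup_err (h n) w)%E].
have mG1 : measurable G1 by exact: measurable_sup_err.
have mG2 : measurable G2.
  rewrite -[X in measurable X]setTI; apply: emeasurable_fun_c_infty => //.
  exact: measurable_sqr_err.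
have mG3 : measurable G3.
  by rewrite -[X in measurable X]setTI; exact: emeasurable_fun_c_infty.
have mE := measurable_exp_integral.
have Xae : {ae P, forall w, [set: T] w -> ((X w)%:E <= ((1 + eta) * exp_integral w)%:E
    + ((C * \1_G2 w)%:E + ((C * \1_G3 w)%:E
    + ((dl / 2 * X w ^+ 2)%:E + ((2 * dl)^-1 * \1_G1 w)%:E))))%E}.
  move: I_bounded A_fin; apply: filterS2 => w Ic Aoo _.
  have := exp_integral_pointwise (ah n) eps0 eps1 dl0 (erefl C) Ic Aoo (X0 w)
    (Xu w) (XS w).
  move=> Xle; rewrite -!EFinD lee_fin; apply: le_trans Xle _.
  rewrite -/G1 -/G2 -/G3 !addrA lerD2r lerD2r lerD2r lerD2r.
  by apply: ler_wpM2r; [exact: expR_ge0|exact: kappaE].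
have mCG (k : R) (G : set T) : measurable G -> measurable_fun setT (fun w => (k * \1_G w)%:E).
  by move=> mG; apply/measurable_EFinP; apply: measurable_funM.
have CG0 (k : R) (G : set T) w : 0 <= k -> (0 <= (k * \1_G w)%:E)%E.
  by move=> k0; rewrite lee_fin mulr_ge0.
have iCG (k : R) (G : set T) : 0 <= k -> measurable G ->
    (\int[P]_w (k * \1_G w)%:E = k%:E * P G)%E.
  move=> k0 mG; under eq_integral do rewrite EFinM.
  rewrite ge0_integralZl//; last exact/measurable_EFinP/measurable_indic.
  by rewrite integral_indic// setIT.
have mX2 : measurable_fun setT (fun w => (dl / 2 * X w ^+ 2)%:E).
  by apply/measurable_EFinP; apply: measurable_funM => //; exact: measurable_funX.
have mE2 : measurable_fun setT (fun w => ((1 + eta) * exp_integral w)%:E).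
  by apply/measurable_EFinP; apply: measurable_funM.
have E20 w : (0 <= ((1 + eta) * exp_integral w)%:E)%E.
  by rewrite lee_fin mulr_ge0 ?expR_ge0// addr_ge0// ltW.
have X20 w : (0 <= (dl / 2 * X w ^+ 2)%:E)%E.
  by rewrite lee_fin mulr_ge0 ?sqr_ge0// divr_ge0// ltW.
have dli : 0 <= (2 * dl)^-1 by rewrite invr_ge0 mulr_ge0// ltW.
have m1 := mCG C G2 mG2; have m2 := mCG C G3 mG3; have m4 := mCG (2 * dl)^-1 G1 mG1.
have m34 := emeasurable_funD mX2 m4; have m234 := emeasurable_funD m2 m34.
have m1234 := emeasurable_funD m1 m234.
have h34 w : (0 <= (dl / 2 * X w ^+ 2)%:E + ((2 * dl)^-1 * \1_G1 w)%:E)%E.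
  by apply: adde_ge0; [exact: X20|exact: CG0].
have h234 w : (0 <= (C * \1_G3 w)%:E +
    ((dl / 2 * X w ^+ 2)%:E + ((2 * dl)^-1 * \1_G1 w)%:E))%E.
  by apply: adde_ge0; [apply: CG0; exact: ltW|exact: h34].
have h1234 w : (0 <= (C * \1_G2 w)%:E + ((C * \1_G3 w)%:E +
    ((dl / 2 * X w ^+ 2)%:E + ((2 * dl)^-1 * \1_G1 w)%:E)))%E.
  by apply: adde_ge0; [apply: CG0; exact: ltW|exact: h234].
rewrite -X1; apply: (@le_trans _ _ (\int[P]_w (((1 + eta) * exp_integral w)%:E
    + ((C * \1_G2 w)%:E + ((C * \1_G3 w)%:E
    + ((dl / 2 * X w ^+ 2)%:E + ((2 * dl)^-1 * \1_G1 w)%:E))))%E)%E).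
  apply: ae_ge0_le_integral => //.
  - by move=> w _; rewrite lee_fin.
  - exact/measurable_EFinP.
  - by move=> w _; apply: adde_ge0; [exact: E20|exact: h1234].
  - exact: emeasurable_funD.
rewrite ge0_integralD// ge0_integralD//; last by move=> w _; apply: CG0; exact: ltW.
rewrite ge0_integralD//; last by move=> w _; apply: CG0; exact: ltW.
rewrite ge0_integralD//; last by move=> w _; exact: CG0.
have C0' := ltW C0; rewrite !iCG//.
have -> : (\int[P]_w ((1 + eta) * exp_integral w)%:E =
    (1 + eta)%:E * \int[P]_w (exp_integral w)%:E)%E.
  under eq_integral do rewrite EFinM.
  by rewrite ge0_integralZl//; [exact/measurable_EFinP|
    move=> w _; rewrite lee_fin expR_ge0|rewrite lee_fin addr_ge0// ltW].
have iX2 : (\int[P]_w (dl / 2 * X w ^+ 2)%:E <= (eta / 2)%:E)%E.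
  under eq_integral do rewrite EFinM.
  rewrite ge0_integralZl//; last by rewrite lee_fin divr_ge0// ltW.
  - apply: le_trans (lee_wpmul2l _ X2) _; first by rewrite lee_fin divr_ge0// ltW.
    by rewrite -EFinM lee_fin /dl mulrAC divfK// gt_eqF// expR_gt0.
  - by apply/measurable_EFinP; exact: measurable_funX.
  - by move=> w _; rewrite lee_fin sqr_ge0.
apply: leeD => //.
apply: (@le_trans _ _ (eta%:E + (eta%:E + ((eta / 2)%:E + (eta / 2)%:E)))%E); last first.
  by rewrite -!EFinD lee_fin; lra.
have G2' : (C%:E * P G2 <= eta%:E)%E.
  by rewrite muleC -lee_pdivlMr// -EFinM -?EFin_inv ltW.
have G3' : (C%:E * P G3 <= eta%:E)%E.
  by rewrite muleC -lee_pdivlMr// ltW.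
have G1' : ((2 * dl)^-1%:E * P G1 <= (eta / 2)%:E)%E.
  apply: (@le_trans _ _ ((2 * dl)^-1%:E * (dl * eta)%:E)%E).
    by apply: lee_wpmul2l; [rewrite lee_fin|exact: ltW].
  rewrite -EFinM lee_fin invfM mulrA -[_ * dl^-1 * dl]mulrA mulVf ?gt_eqF//.
  by rewrite mulr1 mulrC.
by apply: leeD => //; apply: leeD => //; exact: leeD.
Qed.

Lemma exp_integral_ge1 : (1 <= \int[P]_w (exp_integral w)%:E)%E.
Proof.
have E0 : (0 <= \int[P]_w (exp_integral w)%:E)%E.
  by apply: integral_ge0 => w _; rewrite lee_fin expR_ge0.
have [Eoo|/negP] := boolP (\int[P]_w (exp_integral w)%:E < +oo)%E; last first.
  by rewrite ltNge => /negP/negPn; apply: le_trans; rewrite leey.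
have EE : (\int[P]_w (exp_integral w)%:E =
    (fine (\int[P]_w (exp_integral w)%:E))%:E)%E.
  by rewrite fineK// ge0_fin_numE.
have := exp_integral_approx; move: E0; rewrite EE.
set e := fine _ => e0 approx; rewrite lee_fin leNgt; apply/negP => e1.
have eta0 : 0 < (1 - e) / 8 by rewrite divr_gt0// subr_gt0.
rewrite lee_fin in e0.
have eta1 : (1 - e) / 8 <= 1 by lra.
have := approx _ eta0 eta1; rewrite -EFinM -EFinD lee_fin.
have : (1 - e) / 8 * e <= (1 - e) / 8 by rewrite ler_piMr// ltW.
lra.
Qed.

End integral_limit.

(** * Martingale property and finiteness of the energy *)
Lemma expR_le_quad (R : realType) (x : R) : x <= 2^-1 ->
  expR x <= 1 + x + 2 * x ^+ 2.
Proof.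
move=> x2; have h : 1 - x <= expR (- x) by exact: expR_ge1Dx.
have x1 : 0 < 1 - x by lra.
rewrite -[x in expR x]opprK expRN; apply: (@le_trans _ _ (1 - x)^-1).
  by rewrite lef_pV2// posrE ?expR_gt0.
rewrite -div1r ler_pdivrMr// -subr_ge0.
rewrite (_ : _ - 1 = x ^+ 2 * (1 - 2 * x)); last by ring.
by rewrite mulr_ge0 ?sqr_ge0//; lra.
Qed.

Lemma bounded_integrable (R : realType) (d : measure_display)
    (T : measurableType d) (P : probability T R) (Y : T -> R) (M : R) :
  measurable_fun setT Y -> (forall w, `|Y w| <= M) ->
  P.-integrable setT (EFin \o Y).
Proof.
move=> mY YM; apply: (@le_integrable _ _ _ P setT _ _ (EFin \o cst M)) => //.
- exact/measurable_EFinP.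
- by move=> w _ /=; rewrite lee_fin (le_trans (YM w))// ler_norm.
- exact: finite_measure_integrable_cst.
Qed.

(** By the bound exp x <= 1 + x + 2 x^2, the number lam E[Y] + 2 lam^2 M^2 is
nonnegative for all small lam of either sign, so that E[Y] = 0. *)
Lemma mean0_of_exp_moments (R : realType) (d : measure_display)
    (T : measurableType d) (P : probability T R) (Y : T -> R) (M : R) :
  measurable_fun setT Y -> (forall w, `|Y w| <= M) ->
  (forall lam : R, (1 <= \int[P]_w (expR (lam * Y w))%:E)%E) ->
  (\int[P]_w (Y w)%:E = 0)%E.
Proof.
move=> mY YM expY.
have M0 : 0 <= M by apply: le_trans (YM point).
have iY := bounded_integrable P mY YM.
set m := fine (\int[P]_w (Y w)%:E)%E.
have mE : (\int[P]_w (Y w)%:E = m%:E)%E.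
  by rewrite fineK//; exact: integrable_fin_num.
have quad (lam : R) : `|lam| * M <= 2^-1 -> 0 <= lam * m + 2 * lam ^+ 2 * M ^+ 2.
  move=> lamM; suff : (1 <= (1 + lam * m + 2 * lam ^+ 2 * M ^+ 2)%:E)%E.
    by rewrite lee_fin -addrA lerDl.
  apply: le_trans (expY lam) _.
  have -> : ((1 + lam * m + 2 * lam ^+ 2 * M ^+ 2)%:E =
     \int[P]_w ((1 + 2 * lam ^+ 2 * M ^+ 2)%:E + lam%:E * (Y w)%:E))%E.
    rewrite integralD//=; last 2 first.
    - exact: finite_measure_integrable_cst.
    - exact: integrableZl.
    rewrite integral_cst//= probability_setT mule1 integralZl// mE -EFinM -EFinD.
    by congr EFin; ring.
  have le1 w : expR (lam * Y w) <= 1 + 2 * lam ^+ 2 * M ^+ 2 + lam * Y w.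
    have lY : `|lam * Y w| <= `|lam| * M by rewrite normrM ler_wpM2l.
    apply: le_trans (expR_le_quad _) _.
      by rewrite (le_trans (ler_norm _))// (le_trans lY).
    have : (lam * Y w) ^+ 2 <= lam ^+ 2 * M ^+ 2.
      rewrite -[leLHS]ger0_norm ?sqr_ge0// normrX.
      by rewrite -[lam ^+ 2]ger0_norm ?sqr_ge0// normrX -exprMn lerXn2r// nnegrE
        mulr_ge0.
    lra.
  apply: ge0_le_integral => //.
  - apply/measurable_EFinP; apply: measurableT_comp => //.
    exact: measurable_funM.
  - apply: emeasurable_funD => //; apply: measurable_funeM.
    exact/measurable_EFinP.
  - by move=> w _; rewrite -EFinM -EFinD lee_fin.
(* the choice lam = - k m makes the quadratic bound negative unless m = 0 *)
pose k := (4 * (M ^+ 2 + `|m| * M + 1))^-1.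
have M2 := sqr_ge0 M.
have mM0 : 0 <= `|m| * M by rewrite mulr_ge0.
have k0 : 0 < k by rewrite invr_gt0; lra.
have kM : k * (M ^+ 2 + `|m| * M + 1) = 4^-1.
  by rewrite /k invfM -mulrA mulVf ?mulr1// gt_eqF//; lra.
have kM1 : 0 <= k * M ^+ 2 by rewrite mulr_ge0// ltW.
have kM2 : 0 <= k * (`|m| * M) by rewrite mulr_ge0// ltW.
have := quad (- (k * m)); rewrite normrN normrM (gtr0_norm k0) => h.
have {}h : 0 <= - (k * m) * m + 2 * (- (k * m)) ^+ 2 * M ^+ 2.
  by apply: h; rewrite -mulrA; lra.
rewrite mE; congr EFin; apply/eqP; rewrite -sqrf_eq0 eq_le sqr_ge0 andbT.
rewrite leNgt; apply/negP => m2.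
have : 0 < k * m ^+ 2 * (1 - 2 * (k * M ^+ 2)).
  by apply: mulr_gt0; [exact: mulr_gt0|lra].
lra.
Qed.

Section bounded_solution.
Context (R : realType) (d : measure_display) (T : measurableType d)
  (P : probability T R) (W : R -> T -> R) (a b z : R) (sigma : R -> R)
  (Z : R -> T -> R).
Hypothesis hW : brownian_motion P W.
Hypothesis hZ : strong_solution P W sigma z Z.
Hypothesis Z_range : forall (t : R) w, 0 <= t -> a <= Z t w <= b.
Local Notation F := (augmented_filtration P W).

Lemma solution_measurable t : 0 <= t -> measurable_fun setT (Z t).
Proof.
by move=> t0; have [aZ _ _ _] := hZ; apply: (measurable_wrt_fun hW (aZ t _)).
Qed.

Lemma solution_dist t u w : 0 <= t -> 0 <= u -> `|Z t w - Z u w| <= b - a.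
Proof.
move=> t0 u0; have /andP[? ?] := Z_range w t0; have /andP[? ?] := Z_range w u0.
by rewrite ler_norml; lra.
Qed.

Lemma solution_norm_le t w : 0 <= t -> `|Z t w| <= Num.max `|a| `|b|.
Proof.
move=> t0; have /andP[h1 h2] := Z_range w t0.
set M := Num.max _ _; have aM : `|a| <= M by rewrite le_max lexx.
have bM : `|b| <= M by rewrite le_max lexx orbT.
have := ler_norm b; have := ler_norm (- a); rewrite normrN => na nb.
by rewrite ler_norml; apply/andP; split; lra.
Qed.

Lemma ito_part_dist (I : R -> T -> R) :
  {ae P, forall w, forall t : R, 0 <= t -> Z t w = z + I t w} ->
  {ae P, forall w, forall t u, 0 <= t -> 0 <= u -> `|I t w - I u w| <= b - a}.
Proof.
apply: filterS => w ZI t u t0 u0; have := solution_dist w t0 u0.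
by rewrite !ZI// opprD addrACA subrr add0r.
Qed.

Lemma martingale_increment s t (B : set T) : 0 <= s -> s <= t -> F s B ->
  (\int[P]_w (\1_B w * (Z t w - Z s w))%:E = 0)%E.
Proof.
move=> s0 st FB; have t0 := le_trans s0 st.
have [_ _ _ [I [hI ZI]]] := hZ.
have mB : measurable B by exact: (augmented_filtration_sub hW) FB.
have Ib := ito_part_dist ZI.
have mZ : measurable_fun setT (fun w => \1_B w * (Z t w - Z s w)).
  apply: measurable_funM; first exact: measurable_indic.
  by apply: measurable_funB; exact: solution_measurable.
apply: (mean0_of_exp_moments (M := b - a)) => //.
  move=> w; rewrite normrM; apply: le_trans (solution_dist w t0 s0).
  by rewrite ler_piMl// indicE; case: (_ \in _); rewrite ?normr1 ?normr0.
move=> lam; apply: le_trans (exp_integral_ge1 hW hI lam s0 st FB Ib) _.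
apply: ae_ge0_le_integral => //.
- by move=> w _; rewrite lee_fin expR_ge0.
- by apply/measurable_EFinP; exact: (measurable_exp_integral hW hI).
- by apply/measurable_EFinP; apply: measurableT_comp => //; exact: measurable_funM.
- apply: filterS ZI => w ZI _; rewrite lee_fin ler_expR /exp_integral.
  rewrite !ZI// [X in _ <= lam * (_ * X)](_ : _ = I t w - I s w); last by ring.
  rewrite mulrA gerBl divr_ge0// mulr_ge0//.
    by rewrite mulr_ge0 ?sqr_ge0.
  by rewrite fine_ge0// integral_ge0// => r _; rewrite lee_fin sqr_ge0.
Qed.

Definition energy (n : R) w : \bar R :=
  (\int[lebesgue_measure]_(r in `]0%R, n]) (sigma (Z r w) ^+ 2)%:E)%E.

Lemma energy_measurable n : 0 <= n -> measurable_fun setT (energy n).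
Proof.
move=> n0; have [_ _ _ [I [[[pH _] _ _ _] _]]] := hZ.
have jH := progressive_jointly_measurable hW n0 pH.
apply: (measurable_integral_param (f := fun r w => sigma (Z r w) ^+ 2)) => //.
  apply: measurable_funX; apply: measurable_funS jH; first exact: measurableX.
  by move=> [r w] [/=]; rewrite !in_itv/= => /andP[/ltW -> ->].
by move=> r w; exact: sqr_ge0.
Qed.

Lemma energy_ge0 n w : (0 <= energy n w)%E.
Proof. by apply: integral_ge0 => r _; rewrite lee_fin sqr_ge0. Qed.

(** With B the whole space and s = 0, the factor exp (- lam^2/4 energy) is at
most exp (- lam^2 L / 4) where the energy exceeds L, and at most 1
elsewhere. *)
Lemma energy_tail (n lam L : R) : 0 <= n -> 0 <= lam ->
  (P [set w | (L%:E < energy n w)%E] <=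
    (1 - expR (- (lam * (b - a))) + expR (- (lam ^+ 2 * L / 4)))%:E)%E.
Proof.
move=> n0 lam0; have [_ _ _ [I [hI ZI]]] := hZ.
have Ib := ito_part_dist ZI.
have FT : F 0 setT.
  by apply: (@measurableT _ (g_sigma_algebraType (augmented_gen P W 0))).
have := exp_integral_ge1 hW hI lam (lexx 0) n0 FT Ib.
set G := [set w | (L%:E < energy n w)%E].
have mG : measurable G.
  rewrite -[X in measurable X]setTI; apply: emeasurable_fun_o_infty => //.
  exact: energy_measurable.
set e := expR (lam * (b - a)); set f := expR (- (lam ^+ 2 * L / 4)).
have efin : {ae P, forall w, (energy n w < +oo)%E}.
  have [[pH /(_ n n0) Hfin] _ _ _] := hI.
  apply: filterS Hfin => w Hw.
  refine (@le_lt_trans _ _ _ _ _ _ Hw); apply: ge0_subset_integral => //.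
  - have jH := progressive_jointly_measurable hW n0 pH.
    by apply/measurable_EFinP/measurable_funX; exact: (section_measurable _ _ jH).
  - by move=> r _; rewrite lee_fin sqr_ge0.
  - by move=> r /=; rewrite !in_itv/= => /andP[/ltW -> ->].
move=> h1.
have h2 : (1 <= \int[P]_w ((e * f)%:E + (e * \1_(~` G) w)%:E))%E.
  apply: le_trans h1 _; apply: ae_ge0_le_integral => //.
  - by move=> w _; rewrite lee_fin expR_ge0.
  - by apply/measurable_EFinP; exact: (measurable_exp_integral hW hI).
  - by move=> w _; rewrite -EFinD lee_fin addr_ge0// mulr_ge0// expR_ge0.
  - apply/measurable_EFinP; apply: measurable_funD => //.
    by apply: measurable_funM => //; exact/measurable_indic/measurableC.
  - move: Ib efin; apply: filterS2 => w Iw ew _.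
    rewrite -EFinD lee_fin /exp_integral indicT mulr1 mulr1 -/(energy n w).
    have eE : energy n w = (fine (energy n w))%:E.
      by rewrite fineK// ge0_fin_numE// energy_ge0.
    have f0 : 0 <= fine (energy n w) by rewrite fine_ge0// energy_ge0.
    have l2 := sqr_ge0 lam.
    have le_e : lam * (I n w - I 0 w) <= lam * (b - a).
      by rewrite ler_wpM2l// (le_trans (ler_norm _))// Iw.
    rewrite indicE; have [wG|wG] := boolP (w \in ~` G).
      apply: (@le_trans _ _ e); last first.
        by rewrite mulr1 lerDr mulr_ge0// expR_ge0.
      by rewrite ler_expR; apply: le_trans le_e; rewrite gerBl divr_ge0// mulr_ge0.
    rewrite mulr0 addr0 -expRD ler_expR lerB// ler_wpM2r//.
    rewrite ler_wpM2l// -lee_fin -eE ltW//.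
    by move/negP: wG; rewrite inE/= => /contrapT.
have h3 : (1 <= (e * f)%:E + e%:E * P (~` G))%E.
  apply: le_trans h2 _; rewrite ge0_integralD//; last 3 first.
  - by move=> w _; rewrite lee_fin mulr_ge0// expR_ge0.
  - by move=> w _; rewrite lee_fin mulr_ge0// expR_ge0.
  - apply/measurable_EFinP; apply: measurable_funM => //.
    exact/measurable_indic/measurableC.
  rewrite integral_cst//= probability_setT mule1 leeD2l//.
  under eq_integral do rewrite EFinM.
  rewrite ge0_integralZl//; last 2 first.
  - exact/measurable_EFinP/measurable_indic/measurableC.
  - by rewrite lee_fin expR_ge0.
  by rewrite integral_indic ?setIT//; exact: measurableC.
move: h3; rewrite probability_setC//.
have PGE : P G = (fine (P G))%:E by rewrite fineK// fin_num_measure.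
rewrite PGE -[1%E]/(1%:E) -EFinB -EFinM -EFinD !lee_fin expRN -/e.
have e0 : 0 < e by exact: expR_gt0.
have ee : e * e^-1 = 1 by rewrite mulfV// gt_eqF.
move=> h3; rewrite -(ler_pM2l e0); lra.
Qed.

End bounded_solution.

Lemma probability_bigcup_le (R : realType) (d : measure_display)
    (T : measurableType d) (P : probability T R) (E : (set T)^nat) (x : \bar R) :
  (forall n, measurable (E n)) -> nondecreasing_seq E ->
  (forall n, P (E n) <= x)%E -> (P (\bigcup_n E n) <= x)%E.
Proof.
move=> mE ndE PE.
have cE := nondecreasing_cvg_mu (mu := P) mE (bigcupT_measurable _ mE) ndE.
rewrite -(cvg_lim _ cE)//; apply: lime_le; first by apply/cvg_ex; eexists; exact: cE.
exact: nearW.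
Qed.

(** * Crossings of a supermartingale *)
Section phase.
Context (R : realType) (delta eta : R).

(** A betting strategy: phase 0 waits for the first value below delta, phase 1
then holds a unit stake until the first later value at least eta, and phase 2
has cashed in. *)
Fixpoint phase (x : nat -> R) k : nat :=
  match k with
  | 0 => if x 0%N < delta then 1 else 0
  | k'.+1 => match phase x k' with
             | 0 => if x k < delta then 1 else 0
             | 1 => if eta <= x k then 2 else 1
             | _ => 2
             end
  end.

Lemma phase_le2 x k : (phase x k <= 2)%N.
Proof. by case: k => [|k]/=; [case: ifP|case: (phase x k) => [|[|]]; try case: ifP]. Qed.

Lemma phase_mono x i j : (i <= j)%N -> (phase x i <= phase x j)%N.
Proof.
elim: j => [|j IH]; first by rewrite leqn0 => /eqP->.
rewrite leq_eqVlt => /predU1P[->//|ij]; apply: leq_trans (IH ij) _ => /=.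
have := phase_le2 x j.
by case: (phase x j) => [|[|[|]]]//; case: ifP.
Qed.

Lemma phase_crossing x i j : (i < j)%N -> x i < delta -> eta <= x j ->
  phase x j = 2.
Proof.
move=> ij xi xj; have p1 : (0 < phase x i)%N.
  by case: i xi {ij} => [|i] xi /=; rewrite xi//; case: (phase x i) => [|[|]]//; case: ifP.
case: j ij xj => // j ij xj /=.
rewrite ltnS in ij; have := leq_trans p1 (phase_mono x ij).
by have := phase_le2 x j; case: (phase x j) => [|[|[|]]]//; rewrite xj.
Qed.

(** A completed bet gains at least eta - delta, and since the values are
nonnegative an unfinished one loses at most delta. *)
Lemma phase_gain x n : (forall k, 0 <= x k) -> 0 <= delta ->
  eta * (phase x n == 2)%:R - delta <=
  \sum_(k < n) (phase x k == 1)%:R * (x k.+1 - x k).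
Proof.
move=> x0 d0; set S := \sum_(k < n) _.
suff : match phase x n with 0 => S = 0 | 1 => x n - delta <= S
       | _ => eta - delta <= S end.
  have := phase_le2 x n; have xn := x0 n.
  by case: (phase x n) => [|[|[|]]]//= _ h; rewrite ?mulr0 ?mulr1//; lra.
rewrite {}/S; elim: n => [|n IH] /=.
  by rewrite big_ord0; case: ifPn => [?|//] /=; lra.
rewrite big_ord_recr/=; move: IH; set S := \sum_(k < n) _.
have := phase_le2 x n; case: (phase x n) => [|[|[|]]]//= _ IH.
- by case: ifPn => ? /=; rewrite IH mul0r addr0//; lra.
- by case: ifPn => ? /=; rewrite mul1r; lra.
- by rewrite mul0r addr0.
Qed.

End phase.

Section absorption.
Context (R : realType) (d : measure_display) (T : measurableType d)
  (P : probability T R) (W : R -> T -> R) (a b z : R) (sigma : R -> R)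
  (Z : R -> T -> R).
Hypothesis hab : a < b.
Hypothesis hW : brownian_motion P W.
Hypothesis hZ : strong_solution P W sigma z Z.
Hypothesis Z_range : forall (t : R) w, 0 <= t -> a <= Z t w <= b.
Local Notation F := (augmented_filtration P W).
Local Notation energy := (energy sigma Z).

Lemma energy_mono (m n : R) w : 0 <= m -> m <= n -> (energy m w <= energy n w)%E.
Proof.
move=> m0 mn; apply: ge0_subset_integral => //.
- have [_ _ _ [I [[[pH _] _ _ _] _]]] := hZ.
  have n0 := le_trans m0 mn.
  have jH := progressive_jointly_measurable hW n0 pH.
  apply/measurable_EFinP/measurable_funX.
  apply: measurable_funS (section_measurable w _ jH) => //.
  by move=> r /=; rewrite !in_itv/= => /andP[/ltW -> ->].
- by move=> r _; rewrite lee_fin sqr_ge0.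
- by move=> r /=; rewrite !in_itv/= => /andP[-> /le_trans ->].
Qed.

(** In the tail bound, lam is first taken so small that the term
1 - exp (- lam (b - a)) is small, and L then so large that the other term is;
neither choice depends on n. *)
Lemma energy_bounded :
  {ae P, forall w, exists L : nat, forall n : nat, (energy n%:R w <= L%:R%:E)%E}.
Proof.
pose E (L : nat) n := [set w | (L%:R%:E < energy n%:R w)%E].
have mE L n : measurable (E L n).
  rewrite -[X in measurable X]setTI; apply: emeasurable_fun_o_infty => //.
  exact: (energy_measurable hW hZ).
have mD : measurable (\bigcap_L \bigcup_n E L n).
  by apply: bigcapT_measurable => L; exact: bigcupT_measurable.
exists (\bigcap_L \bigcup_n E L n); split => //; last first.
  move=> w /= nw L _; apply: contrapT => nE; apply: nw; exists L => n.
  by rewrite leNgt; apply/negP => h; apply: nE; exists n.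
apply/eqP; rewrite -measure_le0; apply/lee_addgt0Pr => eps eps0; rewrite add0e.
have c0 : 0 < b - a by rewrite subr_gt0.
pose lam := eps / 2 / (b - a).
have lam0 : 0 < lam by apply: divr_gt0 => //; exact: divr_gt0.
pose L := (Num.truncn (8 / (lam ^+ 2 * eps))).+1.
have l2 : 0 < lam ^+ 2 by rewrite exprn_gt0.
have Llarge : 2 / eps <= lam ^+ 2 * L%:R / 4.
  have : 8 / (lam ^+ 2 * eps) < L%:R by exact: truncnS_gt.
  rewrite (ltr_pdivrMr _ _ (mulr_gt0 l2 eps0)) => h.
  rewrite (ler_pdivrMr _ _ eps0); lra.
apply: (@le_trans _ _ (P (\bigcup_n E L n))).
  apply: le_measure; rewrite ?inE//; first exact: bigcupT_measurable.
  by move=> w; apply.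
apply: probability_bigcup_le => //.
  move=> m n mn; apply/subsetPset => w; rewrite /E/= => /lt_le_trans; apply.
  by apply: energy_mono => //; rewrite ler_nat.
move=> n; apply: le_trans (energy_tail hW hZ Z_range L%:R (ler0n R n) (ltW lam0)) _.
rewrite lee_fin.
have h1 : 1 - expR (- (lam * (b - a))) <= eps / 2.
  have := expR_ge1Dx (- (lam * (b - a))).
  by rewrite /lam divfK ?gt_eqF//; lra.
have h2 : expR (- (lam ^+ 2 * L%:R / 4)) <= eps / 2.
  rewrite expRN -[leRHS]invrK lef_pV2 ?posrE ?expR_gt0 ?invr_gt0 ?divr_gt0//.
  have := expR_ge1Dx (lam ^+ 2 * L%:R / 4); rewrite invf_div; lra.
lra.
Qed.

Definition gap t w := Num.min (Z t w - a) (b - Z t w).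

Lemma gap_ge0 t w : 0 <= t -> 0 <= gap t w.
Proof.
by move=> t0; have /andP[h1 h2] := Z_range w t0; rewrite le_min !subr_ge0 h1.
Qed.

Lemma gap_le t w : 0 <= t -> gap t w <= b - a.
Proof.
move=> t0; have /andP[h1 h2] := Z_range w t0; rewrite ge_min; apply/orP; left.
by rewrite lerD2r.
Qed.

Lemma gap_measurable_wrt t : 0 <= t -> measurable_wrt (F t) (gap t).
Proof.
move=> t0; have [aZ _ _ _] := hZ; apply/measurable_wrtP.
by apply: measurable_minr; apply: measurable_funB => //;
  apply/measurable_wrtP; exact: aZ.
Qed.

Lemma gap_measurable t : 0 <= t -> measurable_fun setT (gap t).
Proof. by move=> t0; exact: (measurable_wrt_fun hW (gap_measurable_wrt t0)). Qed.

Let indicM_bounded (G : set T) (x c : R) w : `|x| <= c -> `|\1_G w * x| <= c.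
Proof.
move=> xc; rewrite normrM indicE; case: (_ \in _); rewrite ?normr1 ?normr0.
  by rewrite mul1r.
by rewrite mul0r (le_trans _ xc).
Qed.

(** The gap is the minimum of the martingales Z - a and b - Z.  B is split
according to which of the two is the smaller one at time s; on each part the
gap at time t is at most the later value of the same martingale. *)
Lemma gap_supermartingale s t (B : set T) : 0 <= s -> s <= t -> F s B ->
  (\int[P]_w (\1_B w * (gap t w - gap s w))%:E <= 0)%E.
Proof.
move=> s0 st FB; have t0 := le_trans s0 st.
pose mid := (a + b) / 2.
have [aZ _ _ _] := hZ.
have FZ : F s (Z s @^-1` `]-oo, mid]) by exact: (aZ s s0).
have FB1 : F s (B `&` Z s @^-1` `]-oo, mid]).
  exact: (@measurableI _ (g_sigma_algebraType (augmented_gen P W s))).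
have FB2 : F s (B `\` Z s @^-1` `]-oo, mid]).
  exact: (@measurableD _ (g_sigma_algebraType (augmented_gen P W s))).
set B1 := _ `&` _ in FB1; set B2 := _ `\` _ in FB2.
have sub := augmented_filtration_sub hW.
have mB := sub _ _ FB; have mB1 := sub _ _ FB1; have mB2 := sub _ _ FB2.
have mZ (G : set T) : d.-measurable G ->
    measurable_fun setT (fun w => \1_G w * (Z t w - Z s w)).
  move=> mG; apply: measurable_funM; first exact: measurable_indic.
  by apply: measurable_funB; exact: (solution_measurable hW hZ).
have iZ (G : set T) : d.-measurable G ->
    P.-integrable setT (EFin \o (fun w => \1_G w * (Z t w - Z s w))).
  move=> mG; apply: (@bounded_integrable _ _ _ P _ (b - a)); first exact: mZ.
  by move=> w; apply: indicM_bounded; exact: (solution_dist Z_range).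
have iV : P.-integrable setT (EFin \o (fun w => \1_B w * (gap t w - gap s w))).
  apply: (@bounded_integrable _ _ _ P _ (b - a)).
    apply: measurable_funM; first exact: measurable_indic.
    by apply: measurable_funB; exact: gap_measurable.
  move=> w; apply: indicM_bounded; rewrite ler_norml.
  have := gap_ge0 w t0; have := gap_ge0 w s0; have := gap_le w t0.
  by have := gap_le w s0; lra.
apply: (@le_trans _ _ (\int[P]_w ((\1_B1 w * (Z t w - Z s w))%:E +
    (-1)%:E * (\1_B2 w * (Z t w - Z s w))%:E))%E).
  apply: le_integral => //.
    apply: integrableD => //; first exact: iZ.
    by apply: integrableZl => //; exact: iZ.
  move=> w _ /=; rewrite -EFinM -EFinD lee_fin.
  have -> : (\1_B w : R) = \1_B1 w + \1_B2 w.
    rewrite !indicE /B1 /B2 in_setD in_setI.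
    by case: (w \in B); case: (w \in _); rewrite ?addr0 ?add0r.
  have [Zm|Zm] := leP (Z s w) mid.
    have -> : (\1_B2 w : R) = 0.
      by rewrite indicE memNset// => -[_]; apply; rewrite /= in_itv/= Zm.
    have gs : gap s w = Z s w - a.
      by apply/min_idPl; move: Zm; rewrite /mid; lra.
    have gt : gap t w <= Z t w - a by rewrite ge_min lexx.
    rewrite !addr0 mul0r mulr0 addr0 ler_wpM2l ?indicE//; last by lra.
  have -> : (\1_B1 w : R) = 0.
    by rewrite indicE memNset// => -[_]; rewrite /= in_itv/= leNgt Zm.
  have gs : gap s w = b - Z s w.
    by apply/min_idPr; move: Zm; rewrite /mid; lra.
  have gt : gap t w <= b - Z t w by rewrite ge_min lexx orbT.
  rewrite !add0r mul0r add0r mulN1r -mulrN ler_wpM2l ?indicE//; lra.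
rewrite integralD//=; [|exact: iZ|by apply: integrableZl => //; exact: iZ].
rewrite integralZl//; last exact: iZ.
by rewrite !(martingale_increment hW hZ Z_range)// mule0 adde0.
Qed.

End absorption.

Section crossing.
Context (R : realType) (d : measure_display) (T : measurableType d)
  (P : probability T R) (W : R -> T -> R) (a b z : R) (sigma : R -> R)
  (Z : R -> T -> R).
Hypothesis hW : brownian_motion P W.
Hypothesis hZ : strong_solution P W sigma z Z.
Hypothesis Z_range : forall (t : R) w, 0 <= t -> a <= Z t w <= b.
Local Notation F := (augmented_filtration P W).
Local Notation FT s := (g_sigma_algebraType (augmented_gen P W s)).
Local Notation gap := (gap a b Z).

Section grid.
Variables (u : nat -> R) (delta eta : R).
Hypothesis u0 : forall k, 0 <= u k.
Hypothesis uS : forall k, u k <= u k.+1.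
Hypothesis delta0 : 0 < delta.
Hypothesis eta0 : 0 < eta.

Let ph k w := phase delta eta (fun i => gap (u i) w) k.

Lemma phase_measurable k : measurable_fun [set: FT (u k)] (ph k).
Proof.
have mgap i : measurable_fun [set: FT (u i)] (gap (u i)).
  by apply/measurable_wrtP; exact: (gap_measurable_wrt a b hZ).
elim: k => [|k IH].
  by apply: measurable_fun_ifT => //; exact: measurable_fun_ltr.
have mph : measurable_fun [set: FT (u k.+1)] (ph k).
  move=> _ B mB; rewrite setTI.
  apply: (augmented_filtration_mono (uS k)).
  by have := IH measurableT B mB; rewrite setTI.
have meq m : measurable_fun [set: FT (u k.+1)] (fun w => ph k w == m).
  have mm : measurable_fun setT (fun i : nat => i == m) by [].
  exact: (measurableT_comp mm mph).
have -> : ph k.+1 = (fun w => if ph k w == 0%N then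
    (if gap (u k.+1) w < delta then 1%N else 0%N) else
    if ph k w == 1%N then (if eta <= gap (u k.+1) w then 2%N else 1%N) else 2%N).
  by apply/funext => w; rewrite /ph /=; case: (phase _ _ _ k) => [|[|]].
apply: measurable_fun_ifT => //.
  by apply: measurable_fun_ifT => //; exact: measurable_fun_ltr.
apply: measurable_fun_ifT => //.
by apply: measurable_fun_ifT => //; exact: measurable_fun_ler.
Qed.

Lemma phase_event k m : F (u k) [set w | ph k w = m].
Proof.
have := @phase_measurable k measurableT [set m] Logic.I.
by rewrite setTI.
Qed.

(** Staking on a supermartingale has a nonpositive mean gain, to be compared
with the pathwise lower bound on the gain. *)
Lemma phase_probability n :
  (P [set w | ph n w = 2%N] <= (delta / eta)%:E)%E.
Proof.
have sub := augmented_filtration_sub hW.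
pose G k := [set w | ph k w = 1%N].
have mG k : d.-measurable (G k) by apply: sub; exact: phase_event.
pose S n w := \sum_(k < n) \1_(G k) w * (gap (u k.+1) w - gap (u k) w).
have iG k : P.-integrable setT
    (EFin \o (fun w => \1_(G k) w * (gap (u k.+1) w - gap (u k) w))).
  apply: (@bounded_integrable _ _ _ P _ (b - a)).
    apply: measurable_funM; first exact: measurable_indic.
    by apply: measurable_funB; exact: (gap_measurable a b hW hZ).
  move=> w.
  have := gap_ge0 Z_range w (u0 k); have := gap_ge0 Z_range w (u0 k.+1).
  have := gap_le Z_range w (u0 k); have := gap_le Z_range w (u0 k.+1).
  move=> h1 h2 h3 h4.
  rewrite normrM indicE; case: (_ \in _); rewrite ?normr1 ?normr0 ?mul0r ?mul1r.
    by rewrite ler_norml; lra.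
  exact: le_trans h1.
have SP m : P.-integrable setT (EFin \o S m) /\ (\int[P]_w (S m w)%:E <= 0)%E.
  elim: m => [|m [iS S0]].
    rewrite /S; split.
      rewrite (_ : _ \o _ = cst 0%E); first exact: integrable0.
      by apply/funext => w /=; rewrite big_ord0.
    under eq_integral do rewrite big_ord0.
    by rewrite integral0.
  have SE : EFin \o S m.+1 = (EFin \o S m) \+
      (EFin \o (fun w => \1_(G m) w * (gap (u m.+1) w - gap (u m) w))).
    by apply/funext => w /=; rewrite /S big_ord_recr.
  rewrite SE; split; first exact: integrableD.
  rewrite -[X in (X <= _)%E]/(\int[P]_w (EFin \o S m.+1) w)%E SE integralD//=.
  rewrite -[leRHS]adde0 leeD//.
  exact: (gap_supermartingale hW hZ Z_range (u0 m) (uS m) (@phase_event m 1%N)).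
have mG2 : measurable [set w | ph n w = 2%N] by apply: sub; exact: phase_event.
have [iS Sle] := SP n.
have iG2 : P.-integrable setT (EFin \o \1_[set w | ph n w = 2%N]).
  apply: (@bounded_integrable _ _ _ P _ 1); first exact: measurable_indic.
  by move=> w; rewrite indicE; case: (_ \in _); rewrite ?normr1 ?normr0.
have iG2' : P.-integrable setT (fun w => (eta * \1_[set w | ph n w = 2%N] w)%:E).
  under eq_fun do rewrite EFinM.
  exact: integrableZl.
have le0 : (\int[P]_w ((eta * \1_[set w | ph n w = 2%N] w)%:E + (- delta)%:E) <= 0)%E.
  apply: le_trans Sle; apply: le_integral => //.
    by apply: integrableD => //; exact: finite_measure_integrable_cst.
  move=> w _ /=; rewrite lee_fin.
  have := @phase_gain _ delta eta (fun i => gap (u i) w) n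
    (fun k => gap_ge0 Z_range w (u0 k)) (ltW delta0).
  rewrite /S; congr (_ <= _).
    congr (_ * _ - _); rewrite indicE; congr (nat_of_bool _)%:R.
    by apply/eqP/idP; rewrite inE.
  apply: eq_bigr => k _; congr (_ * _); rewrite indicE; congr (nat_of_bool _)%:R.
  by apply/eqP/idP; rewrite inE.
have PE : P [set w | ph n w = 2%N] = (fine (P [set w | ph n w = 2%N]))%:E.
  by rewrite fineK// fin_num_measure.
have indE : (\int[P]_w (\1_[set w | ph n w = 2%N] w)%:E =
    P [set w | ph n w = 2%N])%E by rewrite integral_indic// setIT.
move: le0; rewrite integralD//=; last exact: finite_measure_integrable_cst.
rewrite integral_cst//= probability_setT mule1.
under eq_integral do rewrite EFinM.
rewrite integralZl//.
rewrite indE PE -EFinM -EFinD !lee_fin ler_pdivlMr//; lra.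
Qed.

End grid.

End crossing.

(** * Convergence of the gap to 0 *)
Section gap_limit.
Context (R : realType) (d : measure_display) (T : measurableType d)
  (P : probability T R) (W : R -> T -> R) (a b z : R) (sigma : R -> R)
  (Z : R -> T -> R).
Hypothesis hW : brownian_motion P W.
Hypothesis hZ : strong_solution P W sigma z Z.
Hypothesis Z_range : forall (t : R) w, 0 <= t -> a <= Z t w <= b.
Local Notation gap := (gap a b Z).

Lemma gap_continuous w : {within `[0, +oo[, continuous (fun t => gap t w)}.
Proof.
have [_ cZ _ _] := hZ => x.
refine (@continuous_min R (subspace `[0 : R, +oo[) (fun t => Z t w - a)
  (fun t => b - Z t w) x _ _).
- by apply: (@cvgB R R^o); [exact: cZ|exact: cvg_cst].
- by apply: (@cvgB R R^o); [exact: cvg_cst|exact: cZ].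
Qed.

(** Crossings are observed at the times k / 2^n up to 2^n.  These grids are
nested, so that the events increase with n. *)
Definition crossing delta eta n : set T := [set w | exists i j,
  [/\ (i < j)%N, (j <= 4 ^ n)%N, gap (dyadic R n i) w < delta &
    eta <= gap (dyadic R n j) w]].

Lemma crossing_measurable delta eta n : measurable (crossing delta eta n).
Proof.
have mgap k : measurable_fun setT (gap (dyadic R n k)).
  by apply: (gap_measurable a b hW hZ); exact: dyadic_ge0.
rewrite (_ : crossing _ _ _ = \bigcup_i \bigcup_j
  (if (i < j <= 4 ^ n)%N then
    (gap (dyadic R n i) @^-1` `]-oo, delta[) `&`
    (gap (dyadic R n j) @^-1` `[eta, +oo[) else set0)).
  apply: bigcupT_measurable => i; apply: bigcupT_measurable => j.
  case: ifPn => // _; apply: measurableI; rewrite -[X in measurable X]setTI.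
  - exact: mgap.
  - exact: mgap.
apply/seteqP; split => w /=.
  move=> [i [j [ij jn h1 h2]]]; exists i => //; exists j => //.
  by rewrite ij jn /= !in_itv/= h1 h2.
move=> [i _ [j _]]; case: ifPn => // /andP[ij jn] /=.
by rewrite !in_itv/= andbT => -[h1 h2]; exists i, j.
Qed.

Lemma dyadicS n k : dyadic R n.+1 (2 * k) = dyadic R n k.
Proof.
by rewrite /dyadic natrM exprS invfM mulrACA divff ?mul1r.
Qed.

Lemma crossing_nondecreasing delta eta : nondecreasing_seq (crossing delta eta).
Proof.
apply/nondecreasing_seqP => n; apply/subsetPset => w [i [j [ij jn h1 h2]]].
exists (2 * i)%N, (2 * j)%N; rewrite !dyadicS; split => //.
- by rewrite ltn_pmul2l.
- by rewrite expnS (leq_trans (leq_mul (leqnn 2) jn))// leq_mul2r orbT.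
Qed.

Lemma crossing_probability delta eta : 0 < delta -> 0 < eta ->
  (P (\bigcup_n crossing delta eta n) <= (delta / eta)%:E)%E.
Proof.
move=> delta0 eta0; apply: probability_bigcup_le.
- by move=> n; exact: crossing_measurable.
- exact: crossing_nondecreasing.
move=> n; have u0 k : 0 <= dyadic R n k by exact: dyadic_ge0.
have uS k : dyadic R n k <= dyadic R n k.+1.
  by rewrite ler_pM2r ?invr_gt0 ?exprn_gt0// ler_nat.
apply: le_trans (phase_probability hW hZ Z_range u0 uS delta0 eta0 (4 ^ n)).
apply: le_measure; rewrite ?inE//; first exact: crossing_measurable.
  apply: (augmented_filtration_sub hW).
  exact: (@phase_event _ _ _ _ _ a b _ _ _ hZ _ delta eta u0 uS (4 ^ n) 2).
move=> w [i [j [ij jn h1 h2]]] /=.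
have := phase_mono delta eta (fun i => gap (dyadic R n i) w) jn.
rewrite (phase_crossing ij h1 h2) => h.
by apply/eqP; rewrite eqn_leq h phase_le2.
Qed.

(** The delay of 1 between u and v makes their dyadic approximations distinct at
every level. *)
Lemma crossing_path w delta eta (u v : R) : 0 <= u -> u + 1 <= v ->
  gap u w < delta -> eta < gap v w -> (\bigcup_n crossing delta eta n) w.
Proof.
move=> u0 uv gu gv; have v0 : 0 <= v by rewrite (le_trans _ uv)// addr_ge0.
have cN : {within `[0, +oo[, continuous (fun t => - gap t w)}.
  by move=> x; apply: (@cvgN R R^o); exact: gap_continuous.
have gu' : - delta < - gap u w by rewrite ltrN2.
have vn : \forall n \near \oo, v <= 2 ^+ n.
  exists (Num.truncn v).+1 => // n /= vn.
  rewrite (le_trans (ltW (truncnS_gt v)))// -natrX ler_nat.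
  by rewrite (leq_trans vn)// ltnW// ltn_expl.
have [n _ /(_ n (leqnn n))] :=
  filterI vn (filterI (@dyadic_eventually_gt R _ u _ cN u0 gu')
    (@dyadic_eventually_gt R _ v _ (@gap_continuous w) v0 gv)).
move=> [v2n [+ h2]]; rewrite ltrN2 => h1.
exists n => //; exists (Num.truncn (u * 2 ^+ n)), (Num.truncn (v * 2 ^+ n)).
have p0 : 0 < (2 : R) ^+ n by rewrite exprn_gt0.
have p1 : 1 <= (2 : R) ^+ n by rewrite exprn_ege1// ler1n.
split => //; last exact: ltW.
- rewrite truncn_gt_nat -natr1 -lerBrDr.
  apply: (@le_trans _ _ (u * 2 ^+ n)).
    by rewrite truncn_le mulr_ge0// ltW.
  by rewrite lerBrDr (le_trans (lerD (lexx _) p1))// -[X in _ + X]mul1r -mulrDl ler_pM2r.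
- rewrite truncn_le_nat; apply: (@le_lt_trans _ _ (2 ^+ n * 2 ^+ n)).
    by rewrite ler_pM2r.
  by rewrite -exprMn -natrM -natrX ltr_nat.
Qed.

(** A path along which the gap comes arbitrarily close to 0 and yet exceeds eta
at arbitrarily large times crosses from every level delta to eta, an event of
probability at most delta / eta for every delta. *)
Lemma gap_cvg0 : {ae P, forall w,
  (forall delta, 0 < delta -> exists2 t, 0 <= t & gap t w < delta) ->
  forall eta, 0 < eta -> exists2 t0, 0 <= t0 & forall t, t0 <= t -> gap t w <= eta}.
Proof.
pose N (k : nat) := \bigcap_m \bigcup_n crossing (m.+1%:R^-1) (k.+1%:R^-1) n.
have mN k : measurable (N k).
  apply: bigcapT_measurable => m; apply: bigcupT_measurable => n.
  exact: crossing_measurable.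
have PN k : P (N k) = 0%E.
  apply/eqP; rewrite -measure_le0; apply/lee_addgt0Pr => e e0; rewrite add0e.
  have ek0 : 0 < e / k.+1%:R by rewrite divr_gt0.
  have [m _ /(_ m (leqnn m)) me] := near_infty_natSinv_lt (PosNum ek0).
  apply: (@le_trans _ _ (P (\bigcup_n crossing (m.+1%:R^-1) (k.+1%:R^-1) n))).
    apply: le_measure; rewrite ?inE//.
      by apply: bigcupT_measurable => n; exact: crossing_measurable.
    by move=> w; apply.
  apply: le_trans (crossing_probability _ _) _; rewrite ?invr_gt0//.
  by rewrite lee_fin invrK -ler_pdivlMr//; exact: ltW.
have : P.-negligible (\bigcup_k N k).
  apply: negligible_bigcup => k; exists (N k); split => //; exact: PN.
apply: negligibleS => w /= nw; apply: contrapT => nN; apply: nw => lim0 eta eta0.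
have [k _ /(_ k (leqnn k)) ke] := near_infty_natSinv_lt (PosNum eta0).
apply: contrapT => nt; apply: nN; exists k => // m _.
have m0 : 0 < (m.+1%:R : R)^-1 by rewrite invr_gt0.
have [u u0 gu] := lim0 _ m0.
have [v uv gv] : exists2 v, u + 1 <= v & k.+1%:R^-1 < gap v w.
  apply: contrapT => nv; apply: nt; exists (u + 1); first by rewrite addr_ge0.
  move=> t ut; rewrite leNgt; apply/negP => gt; apply: nv; exists t => //.
  exact: lt_trans gt.
exact: crossing_path gu gv.
Qed.

End gap_limit.

(** * Convergence to the boundary *)
Lemma locally_holder_continuous (R : realType) (a b c d : R) (f : R -> R) :
  locally_holder (2^-1) a b f -> a < c -> d < b ->
  {within `[c, d], continuous f}.
Proof.
move=> hf ac db.
have sub : `[c, d] `<=` `]a, b[.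
  by move=> x /=; rewrite !in_itv/= => /andP[cx xd]; rewrite (lt_le_trans ac)//
    (le_lt_trans xd).
have [C HC] := hf _ (@segment_compact _ c d) sub.
apply/subspace_continuousP => x xcd; apply/cvgrPdist_lt => e e0.
pose M := `|C| + 1.
have M0 : 0 < M by rewrite ltr_wpDl.
have r0 : 0 < (e / M) ^+ 2 by rewrite exprn_gt0// divr_gt0.
rewrite near_withinE; apply/nbhs_ballP; exists ((e / M) ^+ 2) => //= y xy ycd.
apply: le_lt_trans (HC x y xcd ycd) _.
rewrite powR12_sqrt//.
have s1 : Num.sqrt `|x - y| < e / M.
  have -> : e / M = Num.sqrt ((e / M) ^+ 2).
    by rewrite sqrtr_sqr gtr0_norm// divr_gt0.
  by rewrite ltr_sqrt.
apply: (@le_lt_trans _ _ (M * Num.sqrt `|x - y|)).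
  by rewrite ler_wpM2r ?sqrtr_ge0// /M (le_trans (ler_norm _))// lerDl.
by rewrite mulrC -ltr_pdivlMr.
Qed.

(** Once the gap stays below (b - a) / 4, the path no longer takes the value
(a + b) / 2 and, by the intermediate value theorem, remains on one side. *)
Lemma gap_small_cvg (R : realType) (f : R -> R) (a b : R) : a < b ->
  {within `[0, +oo[, continuous f} ->
  (forall t, 0 <= t -> a <= f t <= b) ->
  (forall eta, 0 < eta -> exists2 t0, 0 <= t0 &
     forall t, t0 <= t -> Num.min (f t - a) (b - f t) <= eta) ->
  f t @[t --> +oo] --> a \/ f t @[t --> +oo] --> b.
Proof.
move=> ab cf fab small.
have eta0 : 0 < (b - a) / 4 by rewrite divr_gt0// subr_gt0.
have [t0 t00 H0] := small _ eta0.
pose mid := (a + b) / 2.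
have nmid t : t0 <= t -> f t != mid.
  move=> t0t; apply/negP => /eqP fm; have := H0 t t0t.
  by rewrite fm ge_min /mid => /orP[] ?; lra.
have ivt t : t0 <= t -> (f t0 < mid) = (f t < mid).
  move=> t0t; have cft : {within `[t0, t], continuous f}.
    apply: continuous_subspaceW cf => x /=; rewrite !in_itv/= andbT => /andP[+ _].
    exact: le_trans.
  have noiv : ~ (Num.min (f t0) (f t) <= mid <= Num.max (f t0) (f t)).
    move=> /(IVT t0t cft)[c]; rewrite in_itv/= => /andP[t0c _] fc.
    by have := nmid c t0c; rewrite fc eqxx.
  apply/idP/idP => h; rewrite ltNge; apply/negP => h'; apply: noiv.
    by rewrite ge_min le_max (ltW h) h' orbT.
  by rewrite ge_min le_max (ltW h) h' orbT.
have toinf t1 (Q : R -> Prop) : (forall t, t1 <= t -> Q t) -> \forall t \near +oo, Q t.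
  move=> H; exists t1; split; first exact: num_real.
  by move=> t /ltW; exact: H.
have [lt_mid|ge_mid] := ltP (f t0) mid.
  left; apply/cvgrPdist_le => e e0; have [t1 t10 H1] := small _ e0.
  apply: (toinf (Num.max t0 t1)) => t; rewrite ge_max => /andP[t0t t1t].
  have ftm : f t < mid by rewrite -ivt.
  have /andP[fa fb] := fab t (le_trans t00 t0t).
  have := H1 t t1t; rewrite (min_idPl _); last by move: ftm; rewrite /mid; lra.
  by rewrite distrC ger0_norm ?subr_ge0.
right; apply/cvgrPdist_le => e e0; have [t1 t10 H1] := small _ e0.
apply: (toinf (Num.max t0 t1)) => t; rewrite ge_max => /andP[t0t t1t].
have ftm : mid <= f t by rewrite leNgt -ivt// -leNgt.
have /andP[fa fb] := fab t (le_trans t00 t0t).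
have := H1 t t1t; rewrite (min_idPr _); last by move: ftm; rewrite /mid; lra.
by rewrite ger0_norm ?subr_ge0.
Qed.

Section boundary_limit.
Context (R : realType) (d : measure_display) (T : measurableType d)
  (P : probability T R) (W : R -> T -> R) (a b z : R) (sigma : R -> R)
  (Z : R -> T -> R).
Hypothesis hab : a < b.
Hypothesis sigma_gt0 : forall x : R, a < x < b -> 0 < sigma x.
Hypothesis sigma_holder : locally_holder (2^-1) a b sigma.
Hypothesis hW : brownian_motion P W.
Hypothesis hZ : strong_solution P W sigma z Z.
Hypothesis Z_range : forall (t : R) w, 0 <= t -> a <= Z t w <= b.

(** Otherwise Z would stay in the compact interval [a + delta, b - delta], on
which sigma has a positive minimum, and the energy would grow linearly. *)
Lemma energy_bounded_gap w (L : nat) :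
  (forall n : nat, (energy sigma Z n%:R w <= L%:R%:E)%E) ->
  forall delta, 0 < delta -> exists2 t, 0 <= t & gap a b Z t w < delta.
Proof.
move=> EL delta delta0; apply: contrapT => no.
have gapD t : 0 <= t -> delta <= gap a b Z t w.
  by move=> t0; rewrite leNgt; apply/negP => h; apply: no; exists t.
have Zcd t : 0 <= t -> Z t w \in `[a + delta, b - delta].
  move=> t0; have := gapD t t0; rewrite le_min in_itv/= => /andP[h1 h2].
  by apply/andP; split; lra.
have cd : a + delta <= b - delta.
  by have := Zcd 0 (lexx 0); rewrite in_itv/= => /andP[]; exact: le_trans.
have csig : {within `[a + delta, b - delta], continuous sigma}.
  by apply: (locally_holder_continuous sigma_holder); lra.
have [c ccd Hc] := EVT_min cd csig.
have sc : 0 < sigma c.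
  by apply: sigma_gt0; move: ccd; rewrite in_itv/= => /andP[h1 h2]; apply/andP; split; lra.
have sc2 : 0 < sigma c ^+ 2 by rewrite exprn_gt0.
pose n := (Num.truncn (L%:R / sigma c ^+ 2)).+1.
have : ((sigma c ^+ 2 * n%:R)%:E <= energy sigma Z n%:R w)%E.
  have -> : ((sigma c ^+ 2 * n%:R)%:E =
      \int[lebesgue_measure]_(r in `]0%R, n%:R]) (cst (sigma c ^+ 2)%:E r))%E.
    by rewrite integral_cst//= lebesgue_measure_itv/= lte_fin ltr0n/= sube0.
  apply: ge0_le_integral => //.
  - by move=> r _; rewrite lee_fin sqr_ge0.
  - have [_ _ _ [I [[[pH _] _ _ _] _]]] := hZ.
    have jH := progressive_jointly_measurable hW (ler0n R n) pH.
    apply/measurable_EFinP/measurable_funX.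
    apply: measurable_funS (section_measurable w _ jH) => //.
    by move=> r /=; rewrite !in_itv/= => /andP[/ltW -> ->].
  - move=> r /=; rewrite in_itv/= => /andP[/ltW r0 _].
    by rewrite lee_fin lerXn2r ?nnegrE ?(ltW sc) ?Hc ?Zcd// (le_trans (ltW sc))// Hc// Zcd.
apply/negP; rewrite -ltNge; apply: le_lt_trans (EL n) _.
by rewrite lte_fin mulrC -ltr_pdivrMr//; exact: truncnS_gt.
Qed.

Lemma solution_cvg : {ae P, forall w,
  Z t w @[t --> +oo] --> a \/ Z t w @[t --> +oo] --> b}.
Proof.
have [_ cZ _ _] := hZ.
move: (energy_bounded hab hW hZ Z_range) (gap_cvg0 hW hZ Z_range).
apply: filterS2 => w [L EL] gap0.
apply: gap_small_cvg => //.
- by move=> t t0; exact: Z_range.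
- by move=> eta eta0; apply: gap0 => //; exact: (energy_bounded_gap EL).
Qed.

Lemma solution_mean t : 0 <= t -> (\int[P]_w (Z t w)%:E = z%:E)%E.
Proof.
move=> t0; have [_ _ Z0 _] := hZ.
have mZ u : 0 <= u -> measurable_fun setT (Z u).
  by move=> u0; exact: (solution_measurable hW hZ u0).
have iZ u : 0 <= u -> P.-integrable setT (EFin \o Z u).
  move=> u0; apply: bounded_integrable (mZ u u0) _ => w.
  exact: (solution_norm_le Z_range).
have FT : augmented_filtration P W 0 setT.
  by apply: (@measurableT _ (g_sigma_algebraType (augmented_gen P W 0))).
have inc := martingale_increment hW hZ Z_range (lexx 0) t0 FT.
have iinc : P.-integrable setT (EFin \o (fun w => Z t w - Z 0 w)).
  apply: (@bounded_integrable _ _ _ P _ (b - a)).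
    by apply: measurable_funB; exact: mZ.
  by move=> w; exact: (solution_dist Z_range).
have -> : (\int[P]_w (Z t w)%:E = \int[P]_w ((Z t w - Z 0 w)%:E + (Z 0 w)%:E))%E.
  by apply: eq_integral => w _; rewrite -EFinD subrK.
rewrite integralD//; last exact: (iZ 0).
have -> : (\int[P]_w (Z t w - Z 0 w)%:E = 0)%E.
  by rewrite -[RHS]inc; apply: eq_integral => w _; rewrite indicT mul1r.
rewrite add0e (ae_eq_integral (cst z%:E)) ?integral_cst//= ?probability_setT ?mule1//.
- exact/measurable_EFinP/mZ.
- by apply: filterS Z0 => w /= ->.
Qed.

End boundary_limit.

Theorem corollary1 (R : realType) (d : measure_display) (T : measurableType d)
  (P : probability T R) (W : R -> T -> R) (a b z : R) (sigma : R -> R)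
  (Z : R -> T -> R)
  (hab : a < b)
  (sigma_ge0 : forall x : R, a <= x <= b -> 0 <= sigma x)
  (sigma_a : sigma a = 0)
  (sigma_b : sigma b = 0)
  (sigma_gt0 : forall x : R, a < x < b -> 0 < sigma x)
  (sigma_holder : locally_holder (2^-1) a b sigma)
  (hz : a <= z <= b)
  (hW : brownian_motion P W)
  (hZ : strong_solution P W sigma z Z)
  (Z_range : forall (t : R) w, 0 <= t -> a <= Z t w <= b)
  (Z_absorbed : absorbed P a b Z) :
  exists Zoo : {RV P >-> R},
    [/\ {ae P, forall w, Z t w @[t --> +oo] --> Zoo w},
        {ae P, forall w, Zoo w = a \/ Zoo w = b} &
        forall A : set R, measurable A ->
          distribution P Zoo A = gbernoulli a b z A].
Proof.
have mZ t : 0 <= t -> measurable_fun setT (Z t).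
  by move=> t0; exact: (solution_measurable hW hZ t0).
pose mid := (a + b) / 2.
(* since Z tends to a or to b, the limit is a exactly when Z is eventually
   below the midpoint along the integers *)
pose E := \bigcup_N \bigcap_n (if (N <= n)%N then Z n%:R @^-1` `]-oo, mid[ else setT).
have mE : measurable E.
  apply: bigcupT_measurable => N; apply: bigcapT_measurable => n.
  case: ifP => // _; rewrite -[X in measurable X]setTI.
  by apply: mZ => //; exact: measurable_itv.
pose zoo w := b + (a - b) * \1_E w.
have mzoo : measurable_fun setT zoo.
  apply: measurable_funD => //; exact: measurable_funM.
pose Zoo : {RV P >-> R} := HB.pack zoo (isMeasurableFun.Build _ _ _ _ _ mzoo).
have zooE w : E w -> zoo w = a.
  by move=> Ew; rewrite /zoo indicE mem_set// mulr1 addrC subrK.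
have zooNE w : ~ E w -> zoo w = b.
  by move=> nEw; rewrite /zoo indicE memNset// mulr0 addr0.
have zoo_ab w : zoo w = a \/ zoo w = b.
  by have [Ew|nEw] := pselect (E w); [left; exact: zooE|right; exact: zooNE].
have cvg_nat w (l : R) : Z t w @[t --> +oo] --> l -> Z n%:R w @[n --> \oo] --> l.
  move=> cZ; apply: (cvg_comp (fun n : nat => n%:R) (Z^~ w) _ cZ).
  exact: cvgr_idn.
have zoo_cvg : {ae P, forall w, Z t w @[t --> +oo] --> zoo w}.
  apply: filterS (solution_cvg hab sigma_gt0 sigma_holder hW hZ Z_range) => w.
  move=> [cZ|cZ]; have cZn := cvg_nat _ _ cZ.
    rewrite zooE//.
    have am : a < mid by rewrite /mid; lra.
    have [N _ HN] := cvgr_lt _ cZn _ am.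
    by exists N => // n _; case: ifPn => // Nn; rewrite /= in_itv/=; exact: HN.
  rewrite zooNE// => -[N _ HN].
  have mb : mid < b by rewrite /mid; lra.
  have [M _ HM] := cvgr_gt _ cZn _ mb.
  have := HN (maxn N M) Logic.I; rewrite leq_maxl/= in_itv/= ltNge => /negP; apply.
  by apply/ltW/HM; exact: leq_maxr.
exists Zoo; split => //; first exact: aeW.
move=> A mA.
pose c := Num.max `|a| `|b|.
have zoo_mean : (\int[P]_w (zoo w)%:E = z%:E)%E.
  have := @dominated_convergence _ T R P setT measurableT
    (fun n w => (Z n%:R w)%:E) (fun w => (zoo w)%:E) (cst c%:E).
  case=> //.
  - by move=> n; apply/measurable_EFinP; exact: mZ.
  - exact/measurable_EFinP.
  - apply: filterS zoo_cvg => w cw _; apply: cvg_EFin; first exact: nearW.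
    exact: cvg_nat cw.
  - exact: finite_measure_integrable_cst.
  - by apply: aeW => w n _; rewrite lee_fin; exact: (solution_norm_le Z_range).
  move=> _ _ cI; have : (\int[P]_w (Z n%:R w)%:E)%E @[n --> \oo] --> z%:E.
    rewrite (_ : (fun n : nat => _) = cst z%:E); first exact: cvg_cst.
    by apply/funext => n; exact: (solution_mean hW hZ Z_range).
  by move=> cz; exact: (cvg_unique _ cI cz).
have PE : P E = (fine (P E))%:E by rewrite fineK// fin_num_measure.
have PEz : b + (a - b) * fine (P E) = z.
  move: zoo_mean; under eq_integral do rewrite EFinD EFinM.
  rewrite integralD//=; last 2 first.
  - exact: finite_measure_integrable_cst.
  - apply: integrableZl => //.
    apply: (@bounded_integrable _ _ _ P _ 1); first exact: measurable_indic.
    by move=> w; rewrite indicE; case: (_ \in _); rewrite ?normr1 ?normr0.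
  rewrite integral_cst//= probability_setT mule1 integralZl//.
    have -> : (\int[P]_w (\1_E w)%:E = P E)%E by rewrite integral_indic// setIT.
    by rewrite PE -EFinM -EFinD => -[].
  apply: (@bounded_integrable _ _ _ P _ 1); first exact: measurable_indic.
  by move=> w; rewrite indicE; case: (_ \in _); rewrite ?normr1 ?normr0.
(* the mean of the limit is z, which fixes the mass of a *)
have P1 : 1 - (z - a) / (b - a) = fine (P E).
  by rewrite -PEz; field; rewrite gt_eqF// subr_gt0.
rewrite /gbernoulli P1 (_ : (z - a) / (b - a) = 1 - fine (P E)); last by rewrite -P1; ring.
have PnE : P (~` E) = (1 - fine (P E))%:E.
  by rewrite probability_setC// PE -EFinB.
rewrite -[LHS]/(P (zoo @^-1` A)) !diracE.
have [Aa|Aa] := pselect (A a); have [Ab|Ab] := pselect (A b).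
- rewrite (mem_set Aa) (mem_set Ab) !mule1 -EFinD subrK -[RHS](probability_setT P).
  congr (P _).
  by apply/seteqP; split => // w _ /=; have [->|->] := zoo_ab w.
- rewrite (mem_set Aa) (memNset Ab) mule0 add0e mule1 -PE; congr (P _).
  apply/seteqP; split => w /=; last by move/zooE ->.
  by move=> Aw; apply: contrapT => /zooNE h; apply: Ab; rewrite -h.
- rewrite (memNset Aa) (mem_set Ab) mule0 adde0 mule1 -PnE; congr (P _).
  apply/seteqP; split => w /=; last by move/zooNE ->.
  by move=> Aw /zooE h; apply: Aa; rewrite -h.
- rewrite (memNset Aa) (memNset Ab) !mule0 adde0 -[RHS](measure0 P); congr (P _).
  by apply/seteqP; split => // w /=; have [->|->] := zoo_ab w.
Qed.
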